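(* There exist open differential relations $\mathcal{R}\subset J^r(X)$, for some smooth fibre bundles $X\to M$, with the following properties. (a) $\mathcal{R}$ is ample up to avoidance and Diff-invariant. (b) $\mathcal{R}$ is not ample, nor ample in coordinate directions. (c) To each formal solution $F:M\to\mathcal{R}$ one can associate a differential relation $\mathcal{R}(F)\subset\mathcal{R}$ having $F$ as a formal solution, such that each $\mathcal{R}(F)$ is ample in coordinate directions; but the relations $\mathcal{R}(F)$ are not necessarily ample nor Diff-invariant (i.e. it is not the case that all $\mathcal R(F)$ are ample, and it is not the case that all $\mathcal R(F)$ are Diff-invariant).
   Context: Jets. $J^r(X)$ is the bundle of $r$-jets of sections of $X\to M$, with projections $\pi^r_{r'}:J^r(X)\to J^{r'}(X)$. A section of $J^r(X)\to M$ is holonomic if it equals $j^rf$ for a section $f$ of $X$. Over-relations. An over-relation of order $r$ is a smooth manifold $\mathcal{R}$ with a smooth map $\iota:\mathcal{R}\to J^r(X)$; it is a differential relation if $\iota$ is an inclusion, and open if $\iota$ is a submersion. Then $\pi^r_{r'}\circ\iota:\mathcal R\to J^{r'}(X)$ is an over-relation of order $r'\le r$. A formal solution is a section $F:M\to\mathcal{R}$ of $\mathcal R\to M$. A relation is Diff-invariant if $X$ is a natural bundle (such as a bundle of tensors or of planes in $TM$), so that (local) diffeomorphisms of $M$ act on $J^r(X)$, and the relation is preserved by this action. Principal subspaces. For a hyperplane $\tau=\ker\lambda\subset T_pM$ and $z\in J^r(X)$ over $p$, $\mathrm{Pr}_{\tau,z}$ is the affine subspace of the fibre of $\pi^r_{r-1}$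 through $z$ which in local coordinates with base $V$ and fibre $W$ is $\{z+\lambda^{\otimes r}\otimes w\mid w\in W\}$. For $F\in\mathcal R$, $\mathrm{Pr}_{\tau,F}:=\mathrm{Pr}_{\tau,\iota(F)}$ and $\mathcal{R}_{\tau,F}:=\iota^{-1}(\mathrm{Pr}_{\tau,F})$. Ampleness. A continuous map $\iota:C\to A$ from a topological space to an affine space is ample if for every $c\in C$ the convex hull of the image of the path-component of $c$ is $A$. An over-relation is ample along (the principal direction of) $\tau\subset T_pM$ if $\iota:\mathcal R_{\tau,F}\to\mathrm{Pr}_{\tau,F}$ is ample for every $F\in\mathcal R$ over $p$. It is ample (in all principal directions) if each $\pi^r_{r'}\circ\iota$, $r'=1,\dots,r$, is ample along all hyperplanes. Principal frames. A principal frame of order $r$ is a collection of hyperplane fields, all defined on (a neighbourhood of the closure of) the same open $U\subset M$, each integrating to a codimension-1 foliation, whose principal directions at each point of $U$ span the fibre of $\pi^r_{r-1}$ and which is minimal with this property. The relation is ample in coordinate directions (= ample along principal frames) if for each $r'=1,\dots,r$ every $p\in M$ admits a principal frame of order $r'$ with support $U\ni p$ such that $\pi^r_{r'}\circ\iota$ is ample along all hyperplanes of the frame. Templates. $\mathrm{H\text{-}Conf}_a(V)$ is the manifold of unordered $a$-tuples of pairwise distinct hyperplanes of a vector space $V$, $\mathrm{H\text{-}Conf}(V)=\coprod_{a\ge0}\mathrm{H\text{-}Conf}_a(V)$ (with $\mathrm{H\text{-}Conf}_0(V)=\{\emptyset\}$), and $\mathrm{H\text{-}Conf}(TM)\to M$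 is the corresponding bundle. For $\mathcal{A}\subset\mathcal{R}\times_M\mathrm{H\text{-}Conf}(TM)$ write $\mathcal{A}(\Xi)=\{F\mid(F,\Xi)\in\mathcal A\}$, $\mathcal{A}(F)=\{\Xi\mid(F,\Xi)\in\mathcal A\}$. An avoidance template for an over-relation $\mathcal{R}$ is an open $\mathcal{A}$ with: (I) $\Xi'\subset\Xi$ implies $\mathcal{A}(\Xi)\subset\mathcal{A}(\Xi')$; (II) each $\mathcal{A}(\Xi)$ is ample along all hyperplanes of $\Xi$; (III) for $F\in\mathcal{R}$ over $p$, $\mathcal{A}(F)$ is dense in each $\mathrm{H\text{-}Conf}_m(T_pM)$. An open $\iota:\mathcal R\to J^r(X)$ is ample up to avoidance if each $\pi^r_{r'}\circ\iota$, $r'=1,\dots,r$, admits an avoidance template. *)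

(* Defs.v *)
From HB Require Import structures.
From mathcomp Require Import all_boot all_order all_algebra.
From mathcomp Require Import all_classical all_reals all_analysis.

Set Implicit Arguments.
Unset Strict Implicit.
Unset Printing Implicit Defensive.
Import Order.TTheory GRing.Theory Num.Theory.
Import numFieldNormedType.Exports.
Local Open Scope classical_set_scope.
Local Open Scope ring_scope.
Local Open Scope quotient_scope.

(* Smooth manifolds, fibre bundles, jet bundles, principal subspaces and the
   three notions of ampleness of convex integration.

   Only carriers and atlases are data.  The topology is the one induced by the
   atlas, and the axioms are the predicates [is_manifold] and
   [is_fibre_bundle]; so products and jet spaces are charted spaces by
   definition, with no proof obligation. *)

Definition basis_vec (R : realType) n (i : 'I_n) : 'rV[R]_n := delta_mx 0 i.

Fixpoint iter_partial (R : realType) n (W : normedModType R) (s : seq 'I_n)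
    (f : 'rV[R]_n -> W) : 'rV[R]_n -> W :=
  if s is i :: s' then fun y => 'D_(basis_vec R i) (iter_partial s' f) y
  else f.

Definition smooth_near (R : realType) n (W : normedModType R)
    (f : 'rV[R]_n -> W) (y : 'rV[R]_n) : Prop :=
  \forall y' \near y, forall s : seq 'I_n,
    {for y', continuous (iter_partial s f)} /\
    forall i : 'I_n, derivable (iter_partial s f) y' (basis_vec R i).

Record chart (R : realType) (T : Type) (n : nat) := Chart {
  dom : set T;
  coord : T -> 'rV[R]_n (* only meaningful on [dom] *) }.

Record charted (R : realType) (n : nat) := Charted {
  carrier :> Type;
  atlas : set (chart R carrier n) }.

Arguments atlas {R n} M _ : rename.

Section ChartedTopology.
Context (R : realType) (n : nat) (M : charted R n).

HB.instance Definition _ := gen_eqMixin (carrier M).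
HB.instance Definition _ := gen_choiceMixin (carrier M).

Definition chart_open (O : set M) : Prop :=
  forall c, atlas M c -> forall x, dom c x -> O x ->
  \forall y \near coord c x, forall x', dom c x' -> coord c x' = y -> O x'.

Lemma chart_openT : chart_open setT.
Proof. by move=> c _ x _ _; near=> y. Unshelve. all: by end_near. Qed.

Lemma chart_openI : setI_closed chart_open.
Proof.
move=> A B oA oB c Mc x cx [Ax Bx].
move: (oA c Mc x cx Ax) (oB c Mc x cx Bx); apply: filterS2 => y hA hB x' cx' e.
by split; [exact: hA|exact: hB].
Qed.

Lemma chart_open_bigU (I : Type) (f : I -> set M) :
  (forall i, chart_open (f i)) -> chart_open (\bigcup_i f i).
Proof.
move=> of_ c Mc x cx [i _ fx]; move: (of_ i c Mc x cx fx).
by apply: filterS => y h x' cx' e; exists i => //; exact: h.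
Qed.

HB.instance Definition _ := isOpenTopological.Build (carrier M)
  chart_openT chart_openI chart_open_bigU.

End ChartedTopology.

Section Manifold.
Context (R : realType) (n : nat) (M : charted R n).

(* Inverse of a chart; the point x0 of the chart is only a default value
   outside the image. *)
Definition chart_inv (c : chart R M n) (x0 : M) (y : 'rV[R]_n) : M :=
  xget x0 [set x | dom c x /\ coord c x = y].

(* The image of dom c `&` dom c' under c is open, and c' \o c^-1 is smooth
   there. *)
Definition smooth_transition (c c' : chart R M n) : Prop :=
  forall x, dom c x -> dom c' x ->
    (\forall y \near coord c x,
       exists x', [/\ dom c x', dom c' x' & coord c x' = y]) /\
    smooth_near (coord c' \o chart_inv c x) (coord c x).

(* Membership in the maximal atlas. *)
Definition compatible_chart (c : chart R M n) : Prop :=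
  (forall x x', dom c x -> dom c x' -> coord c x = coord c x' -> x = x') /\
  forall c', atlas M c' -> smooth_transition c c' /\ smooth_transition c' c.

Definition is_manifold : Prop :=
  [/\ forall x : M, exists2 c, atlas M c & dom c x,
      forall c, atlas M c -> compatible_chart c,
      hausdorff_space M &
      @second_countable M].

(* S is an embedded submanifold: around each of its points there is a slice
   chart, with the same slice dimension d everywhere. *)
Definition is_submanifold (S : set M) : Prop :=
  exists d : nat, forall x, S x -> exists c,
    [/\ compatible_chart c, dom c x &
        forall x', dom c x' ->
          (S x' <-> forall i : 'I_n, (d <= i)%N -> coord c x' 0 i = 0)].

Definition smooth_fun_at (g : M -> R) (x : M) : Prop :=
  forall c, atlas M c -> dom c x ->
    smooth_near (g \o chart_inv c x : 'rV[R]_n -> R^o) (coord c x).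

End Manifold.

(* Smoothness on a neighbourhood of x, for a map continuous near x. *)
Definition smooth_at (R : realType) m n (M : charted R m) (N : charted R n)
    (f : M -> N) (x : M) : Prop :=
  {for x, continuous f} /\
  forall c c', atlas M c -> atlas N c' -> dom c x -> dom c' (f x) ->
    smooth_near (coord c' \o f \o chart_inv c x) (coord c x).

Definition euclid (R : realType) m : charted R m :=
  Charted [set Chart [set: 'rV[R]_m] id].

Definition prod_charted (R : realType) m n (M : charted R m) (N : charted R n) :
    charted R (m + n) :=
  Charted [set c : chart R (M * N) (m + n) | exists a b,
    [/\ atlas M a, atlas N b &
        c = Chart (dom a `*` dom b) (fun x => row_mx (coord a x.1) (coord b x.2))]].

(* A diffeomorphism between open subsets of M. *)
Record loc_diffeo (R : realType) n (M : charted R n) := LocDiffeo {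
  ld_dom : set M;
  ld_fun :> M -> M;
  ld_inv : M -> M;
  ld_dom_open : open ld_dom;
  ld_im_open : open (ld_fun @` ld_dom);
  ld_funK : forall p, ld_dom p -> ld_inv (ld_fun p) = p;
  ld_smooth : forall p, ld_dom p -> smooth_at ld_fun p;
  ld_inv_smooth : forall p, ld_dom p -> smooth_at ld_inv (ld_fun p) }.

Section Tangent.
Context (R : realType) (n : nat) (M : charted R n).

(* A tangent vector is given by its components in each chart at its base
   point, related by the derivatives of the transition maps. *)
Record tvec := TVec {
  tv_pt : M;
  tv_comp : chart R M n -> 'rV[R]_n;
  tv_compat : forall c c', atlas M c -> atlas M c' ->
    dom c tv_pt -> dom c' tv_pt ->
    tv_comp c' = 'D_(tv_comp c) (coord c' \o chart_inv c tv_pt) (coord c tv_pt);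
  tv_default : forall c, ~ (atlas M c /\ dom c tv_pt) -> tv_comp c = 0 }.

(* Kernel, in T_pM, of the covector with components lam in the chart c. *)
Definition covector_ker (c : chart R M n) (p : M) (lam : 'rV[R]_n) :
    set tvec :=
  [set v | tv_pt v = p /\ tv_comp v c *m lam^T = 0].

Definition is_hyperplane (p : M) (tau : set tvec) : Prop :=
  exists c lam, [/\ atlas M c, dom c p, lam != 0 & tau = covector_ker c p lam].

Definition diff_ker (g : M -> R) (p : M) : set tvec :=
  [set v | tv_pt v = p /\
     forall c, atlas M c -> dom c p ->
       'D_(tv_comp v c) (g \o chart_inv c p : 'rV[R]_n -> R^o) (coord c p) = 0].

(* A hyperplane field on O integrating to a codimension-1 foliation: locally
   it is tangent to the level sets of a submersion to R. *)
Definition integrable_field (O : set M) (tau : M -> set tvec) : Prop :=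
  forall q, O q -> exists g : M -> R, \forall q' \near q,
    [/\ smooth_fun_at g q', is_hyperplane q' (tau q') &
        tau q' = diff_ker g q'].

(* Xi is an element of H-Conf_m(T_pM). *)
Definition hconf (p : M) (m : nat) (Xi : set (set tvec)) : Prop :=
  (forall tau, Xi tau -> is_hyperplane p tau) /\ (Xi #= `I_m)%card.

(* The configuration of the kernels of the rows of L.  The topology of
   H-Conf_m(TM) is the quotient topology under these maps, on the open set of
   matrices whose rows are nonzero and pairwise not proportional. *)
Definition rows_conf (c : chart R M n) (p : M) m (L : 'M[R]_(m, n)) :
    set (set tvec) :=
  range (fun i : 'I_m => covector_ker c p (row i L)).

End Tangent.

Record triv (B F T : Type) := Triv {
  tdom : set B;
  tmap : T -> F (* fibre component, only meaningful over [tdom] *) }.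

(* Base dimension n, fibre dimension k. *)
Record bundle (R : realType) (n k : nat) := Bundle {
  base : charted R n;
  fib : charted R k;
  total : Type;
  proj : total -> base;
  trivs : set (triv base fib total) }.

Arguments trivs {R n k} X _ : rename.

Section Bundle.
Context (R : realType) (n k : nat) (X : bundle R n k).

(* Indices of the fibred charts of X. *)
Record fchart := FChart {
  fc_base : chart R (base X) n;
  fc_triv : triv (base X) (fib X) (total X);
  fc_fib : chart R (fib X) k }.

Definition is_fchart (d : fchart) : Prop :=
  [/\ atlas (base X) (fc_base d), trivs X (fc_triv d) &
      atlas (fib X) (fc_fib d)].

Definition fc_dom (d : fchart) : set (total X) :=
  [set x | [/\ dom (fc_base d) (proj x), tdom (fc_triv d) (proj x) &
               dom (fc_fib d) (tmap (fc_triv d) x)]].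

Definition vert_coord (d : fchart) (x : total X) : 'rV[R]_k :=
  coord (fc_fib d) (tmap (fc_triv d) x).

Definition fc_chart (d : fchart) : chart R (total X) (n + k) :=
  Chart (fc_dom d) (fun x => row_mx (coord (fc_base d) (proj x)) (vert_coord d x)).

Definition total_space : charted R (n + k) :=
  Charted [set fc_chart d | d in [set d | is_fchart d]].

(* As the charts of X are the products of charts of the base and of the fibre
   in the local trivialisations, [is_manifold total_space] contains the
   smoothness of the changes of trivialisation. *)
Definition is_fibre_bundle : Prop :=
  [/\ is_manifold (base X), is_manifold (fib X), is_manifold total_space,
      forall p : base X, exists2 t, trivs X t & tdom t p &
      forall t, trivs X t -> open (tdom t) /\
        forall p y, tdom t p -> exists! x, proj x = p /\ tmap t x = y].

Record germ := Germ {
  g_pt : base X;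
  g_sec : base X -> total_space;
  germP : \forall q \near g_pt, proj (g_sec q) = q /\ smooth_at g_sec q }.

HB.instance Definition _ := gen_eqMixin germ.
HB.instance Definition _ := gen_choiceMixin germ.

Definition sec_rep (d : fchart) (g : germ) : 'rV[R]_n -> 'rV[R]_k :=
  vert_coord d \o g_sec g \o chart_inv (fc_base d) (g_pt g).

Definition germ_dom (d : fchart) : set germ :=
  [set g | [/\ dom (fc_base d) (g_pt g), tdom (fc_triv d) (g_pt g) &
               dom (fc_fib d) (tmap (fc_triv d) (g_sec g (g_pt g)))]].

Definition mindex r := {a : {ffun 'I_n -> 'I_r.+1} | (\sum_i a i <= r)%N}.

Definition mi_order r (a : mindex r) : nat := (\sum_i val a i)%N.

Definition mi_seq r (a : mindex r) : seq 'I_n :=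
  flatten [seq nseq (val a i) i | i <- enum 'I_n].

Definition partial_at r (a : mindex r) (d : fchart) (g : germ) : 'rV[R]_k :=
  iter_partial (mi_seq a) (sec_rep d g) (coord (fc_base d) (g_pt g)).

Definition jet_equiv r (g h : germ) : Prop :=
  [/\ g_pt g = g_pt h, g_sec g (g_pt g) = g_sec h (g_pt h) &
      forall d, is_fchart d -> germ_dom d g ->
        forall a : mindex r, partial_at a d g = partial_at a d h].

Definition jet_equivb r : rel germ := fun g h => `[< jet_equiv r g h >].

Lemma jet_equivP r : equiv_class_of (@jet_equivb r).
Proof.
have dom_eq d g h : g_pt g = g_pt h -> g_sec g (g_pt g) = g_sec h (g_pt h) ->
    germ_dom d g -> germ_dom d h.
  by rewrite /germ_dom /= => -> ->.
split.
- by move=> g; apply/asboolP.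
- move=> g h; apply/asboolP/asboolP => -[e1 e2 H]; split=> // d Xd dg a;
    by rewrite H //; apply: dom_eq dg.
- move=> h g l /asboolP[e1 e2 H] /asboolP[e3 e4 H'].
  apply/asboolP; split; [by rewrite e1|by rewrite e2|].
  by move=> d Xd dg a; rewrite H // H' //; apply: dom_eq dg.
Qed.

Canonical jet_equiv_rel r := EquivRelPack (@jet_equivP r).

Definition jet r := {eq_quot (jet_equiv_rel r)}.

Definition jet_of r (g : germ) : jet r := \pi_(jet r) g.

Definition jrepr r (z : jet r) : germ := repr z.

Definition jbase r (z : jet r) : base X := g_pt (jrepr z).

(* The projection J^r(X) -> J^r'(X), for r' <= r. *)
Definition jproj r r' (z : jet r) : jet r' := jet_of r' (jrepr z).

Definition jdim r := (n + #|{: mindex r}| * k)%N.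

(* Coordinates on J^r(X): base point and all partial derivatives of order at
   most r. *)
Definition jcoord r (d : fchart) (z : jet r) : 'rV[R]_(jdim r) :=
  row_mx (coord (fc_base d) (jbase z))
    (mxvec (\matrix_(i < #|{: mindex r}|, j < k)
              partial_at (enum_val i) d (jrepr z) 0 j)).

Definition jdom r (d : fchart) : set (jet r) := [set z | germ_dom d (jrepr z)].

Definition jet_space r : charted R (jdim r) :=
  Charted [set Chart (@jdom r d) (jcoord d) | d in [set d | is_fchart d]].

(* The coordinates of the tensor lam^{(x)r} (x) w: as a w-valued symmetric
   r-linear map, its component along d^a, for |a| = r, is lam^a w. *)
Definition pure_power r (lam : 'rV[R]_n) (w : 'rV[R]_k) : 'rV[R]_(jdim r) :=
  row_mx 0 (mxvec (\matrix_(i < #|{: mindex r}|, j < k)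
    (let a : mindex r := enum_val i in
     if mi_order a == r then (\prod_l lam 0 l ^+ val a l) * w 0 j else 0))).

(* Pr_{tau, z} *)
Definition principal r (tau : set (tvec (base X))) (z : jet_space r) :
    set (jet_space r) :=
  [set z' | exists d lam w,
    [/\ is_fchart d, jdom d z, jdom d z', lam != 0 &
        tau = covector_ker (fc_base d) (jbase z) lam /\
        jcoord d z' = jcoord d z + pure_power r lam w]].

End Bundle.

Definition conv_hull (R : realType) (V : lmodType R) (A : set V) : set V :=
  [set x | exists m (t : 'I_m -> R) (y : 'I_m -> V),
    [/\ forall i, 0 <= t i, \sum_i t i = 1, forall i, A (y i) &
        x = \sum_i t i *: y i]].

Definition aff_hull (R : realType) (V : lmodType R) (A : set V) : set V :=
  [set x | exists m (t : 'I_m -> R) (y : 'I_m -> V),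
    [/\ \sum_i t i = 1, forall i, A (y i) & x = \sum_i t i *: y i]].

Definition path_comp (R : realType) (T : topologicalType) (C : set T) (x : T) :
    set T :=
  [set y | exists gam : R -> T,
    [/\ {within `[0, 1]%classic, continuous gam}, gam 0 = x, gam 1 = y &
        forall s, 0 <= s <= 1 -> C (gam s)]].

Definition ample_map (R : realType) (T : topologicalType) (V : lmodType R)
    (C : set T) (h : T -> V) (A : set V) : Prop :=
  forall x, C x -> conv_hull (h @` path_comp R C x) = A.

Section Ampleness.
Context (R : realType) (n k : nat) (X : bundle R n k).
Local Notation M := (base X).

(* An over-relation of order r is presented as a subspace S of a space T with
   a map iota : T -> J^r(X).  For a differential relation S of order r, seen as
   an over-relation of order r' <= r, T is J^r(X) and iota is the projection
   to J^r'(X). *)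

(* Ampleness along the hyperplane tau of T_pM.  The fibres of
   J^r(X) -> J^{r-1}(X) get their affine structure from any chart of J^r(X)
   of the form [jcoord d]. *)
Definition ample_along (T : topologicalType) r (S : set T)
    (iota : T -> jet_space X r) (p : M) (tau : set (tvec M)) : Prop :=
  forall F, S F -> jbase (iota F) = p ->
  forall d, is_fchart d -> jdom d (iota F) ->
    ample_map (S `&` iota @^-1` principal tau (iota F))
      (fun G => jcoord d (iota G))
      ((@jcoord _ _ _ X r d) @` principal tau (iota F)).

Definition ample r (S : set (jet_space X r)) : Prop :=
  forall r', (1 <= r' <= r)%N -> forall p tau, is_hyperplane p tau ->
    ample_along S (@jproj _ _ _ X r r' : _ -> jet_space X r') p tau.

(* The principal directions of the fields in Phi span, at each point of U, the
   fibre of J^r(X) -> J^{r-1}(X).  All principal subspaces at z contain z, so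
   adding z only matters when Phi is empty. *)
Definition spans_fibres r (U : set M) (Phi : set (M -> set (tvec M))) : Prop :=
  forall z : jet_space X r, U (jbase z) ->
  forall d, is_fchart d -> jdom d z ->
    aff_hull ((@jcoord _ _ _ X r d) @`
      (z |` \bigcup_(tau in Phi) principal (tau (jbase z)) z)) =
    (@jcoord _ _ _ X r d) @` [set z' | jproj r.-1 z' = jproj r.-1 z].

Definition principal_frame r (U : set M) (Phi : set (M -> set (tvec M))) :
    Prop :=
  [/\ open U,
      exists2 O, open O /\ closure U `<=` O &
        forall tau, Phi tau -> integrable_field O tau,
      spans_fibres r U Phi &
      forall Psi, Psi `<=` Phi -> spans_fibres r U Psi -> Psi = Phi].

Definition ample_coord r (S : set (jet_space X r)) : Prop :=
  forall r', (1 <= r' <= r)%N -> forall p : M, exists U Phi,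
    [/\ principal_frame r' U Phi, U p &
        forall q tau, U q -> Phi tau ->
          ample_along S (@jproj _ _ _ X r r' : _ -> jet_space X r') q (tau q)].

Section Template.
Context (T : topologicalType) (r : nat) (S : set T) (iota : T -> jet_space X r).
Local Notation pt F := (jbase (iota F)).

(* A is a relatively open subset of S x_M H-Conf(TM). *)
Definition open_in_hconf (A : set (T * set (set (tvec M)))) : Prop :=
  (forall F Xi, A (F, Xi) -> S F /\ exists m, hconf (pt F) m Xi) /\
  forall m c F (L : 'M[R]_(m, n)), atlas M c -> dom c (pt F) ->
    hconf (pt F) m (rows_conf c (pt F) L) -> A (F, rows_conf c (pt F) L) ->
    \forall F' \near F & L' \near L, S F' -> A (F', rows_conf c (pt F') L').

Definition dense_in_hconf (p : M) m (Q : set (set (set (tvec M)))) : Prop :=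
  forall c (L : 'M[R]_(m, n)), atlas M c -> dom c p ->
    hconf p m (rows_conf c p L) ->
    closure [set L' : 'M[R]_(m, n) | hconf p m (rows_conf c p L') /\
                                     Q (rows_conf c p L')] L.

Definition avoidance_template (A : set (T * set (set (tvec M)))) : Prop :=
  [/\ open_in_hconf A,
      forall F Xi Xi', Xi' `<=` Xi -> A (F, Xi) -> A (F, Xi'),
      forall p m Xi, hconf p m Xi -> forall tau, Xi tau ->
        ample_along [set F | A (F, Xi)] iota p tau &
      forall F m, S F -> dense_in_hconf (pt F) m [set Xi | A (F, Xi)]].

End Template.

Definition ample_up_to_avoidance r (S : set (jet_space X r)) : Prop :=
  forall r', (1 <= r' <= r)%N -> exists A,
    avoidance_template S (@jproj _ _ _ X r r' : _ -> jet_space X r') A.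

Definition formal_solution r (S : set (jet_space X r))
    (F : M -> jet_space X r) : Prop :=
  forall p, [/\ jbase (F p) = p, S (F p) & smooth_at F p].

(* The structure of a natural bundle: a local, functorial lift of the local
   diffeomorphisms of M to X, sending smooth families to smooth families.
   Locality is the case where psi is an identity in the fourth clause. *)
Definition is_natural_bundle
    (lift : loc_diffeo M -> total_space X -> total_space X) : Prop :=
  [/\ forall phi x, ld_dom phi (proj x) -> proj (lift phi x) = phi (proj x),
      forall phi x, ld_dom phi (proj x) -> smooth_at (lift phi) x,
      forall phi x, ld_dom phi (proj x) ->
        (\forall q \near (proj x : M), phi q = q) -> lift phi x = x,
      forall (phi psi chi : loc_diffeo M) x, ld_dom phi (proj x) ->
        ld_dom psi (phi (proj x)) -> ld_dom chi (proj x) ->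
        (\forall q \near (proj x : M), chi q = psi (phi q)) ->
        lift chi x = lift psi (lift phi x) &
      forall m (phi : 'rV[R]_m -> loc_diffeo M) t x,
        (\forall a \near ((t, proj x) : prod_charted (euclid R m) M),
           ld_dom (phi a.1) a.2 /\
           smooth_at (fun b : prod_charted (euclid R m) M => phi b.1 b.2 : M) a) ->
        smooth_at (fun b : prod_charted (euclid R m) (total_space X) =>
          lift (phi b.1) b.2) (t, x)].

(* h is a germ of the section phi_* s = lift phi \o s \o phi^-1, where g is a
   germ of s. *)
Definition pushes_germ (lift : loc_diffeo M -> total_space X -> total_space X)
    (phi : loc_diffeo M) (g h : germ X) : Prop :=
  [/\ ld_dom phi (g_pt g), g_pt h = phi (g_pt g) &
      \forall q \near g_pt h, g_sec h q = lift phi (g_sec g (ld_inv phi q))].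

Definition diff_invariant (lift : loc_diffeo M -> total_space X -> total_space X)
    r (S : set (jet_space X r)) : Prop :=
  forall phi g h, pushes_germ lift phi g h -> S (jet_of r g) -> S (jet_of r h).

End Ampleness.

(* Main.v *)
(** A map (x, y, z) : R^2 -> R^3 is asked to satisfy: dz or dx /\ dy is nonzero.
    Along ker lam, a 1-jet with differential D moves in D + lam (x) R^3, on which
    the vector D v, for v spanning ker lam, is constant. If D v = 0 the relation
    reads w_z != 0 and is not ample, so no principal direction is ample
    everywhere. If D v != 0, all immersive jets belong to the relation and the
    others lie on a line of R^3, of codimension 2. Asking D v != 0 for the
    finitely many kernels of a configuration thus gives an avoidance template.
    A formal solution F may have rank one and then its kernel is a bad direction
    which depends on the point; the relation attached to F only keeps the rank
    one differentials whose kernel is strongly contracted by F, so that it is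
    ample along every direction which F does not contract. *)
Require Import Defs.
From HB Require Import structures.
From mathcomp Require Import all_boot all_order all_algebra.
From mathcomp Require Import all_classical all_reals all_analysis.
From mathcomp Require Import ring lra.
Set Implicit Arguments.
Unset Strict Implicit.
Unset Printing Implicit Defensive.
Import Order.TTheory GRing.Theory Num.Theory.
Import numFieldNormedType.Exports.
Local Open Scope classical_set_scope.
Local Open Scope ring_scope.

(** * Smooth maps between coordinate spaces *)

Section Calculus.
Context {R : realType}.

(** The coordinate z spoils ampleness: along the kernel of a rank one differential it splits the
    slice into two half-spaces. The minor dx /\ dy is there so that every immersive jet belongs to
    the relation, and this is what lets avoidance handle several hyperplanes at once: an immersive
    differential kills no vector, so the conditions coming from the other hyperplanes of a
    configuration remove only non-immersive jets from a slice. The target dimension 3 gives these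
    jets codimension 2; in a plane they would cut the slice in two. One ampleness lemma therefore
    serves both the template and the relations attached to formal solutions: it asks that all
    immersive jets over the point are allowed and that no allowed jet kills the kernel of lam. All
    spaces involved have a global chart, so topology and smoothness are those of coordinate spaces.
    Diffeomorphisms act on the source only, so Diff-invariance reduces, by the chain rule, to a
    matrix condition stable under left multiplication by invertible matrices. *)

Lemma continuous_mxP (T : topologicalType) m n (f : T -> 'M[R]_(m, n)) x :
  {for x, continuous f} <-> forall i j, {for x, continuous (fun y => f y i j)}.
Proof.
split=> [cf i j|cf].
  by apply: (@continuous_comp _ _ _ f (fun M => M i j)) => //; exact: coord_continuous.
move=> A [B nB sBA]; rewrite /= nbhs_simpl /=.
have : \forall y \near x, forall i j, B i j (f y i j).
  by apply: filter_forall => i; apply: filter_forall => j; exact: cf.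
by apply: filterS => y By; exact: sBA.
Qed.

Lemma continuous_at_sum (T : topologicalType) (I : Type) (r : seq I) (P : pred I)
    (f : I -> T -> R) x :
  (forall i, P i -> {for x, continuous (f i)}) ->
  {for x, continuous (fun y => \sum_(i <- r | P i) f i y)}.
Proof.
move=> cf; rewrite -fct_sumE; apply: (big_ind (fun g => {for x, continuous g})) => //.
  exact: cst_continuous.
by move=> g h; exact: continuousD.
Qed.

Lemma continuous_mulmxr m n p (A : 'M[R]_(n, p)) :
  continuous (fun x : 'M[R]_(m, n) => x *m A).
Proof.
move=> x; apply/continuous_mxP => i j.
rewrite (_ : (fun y : 'M[R]_(m, n) => _) = (fun y : 'M[R]_(m, n) => \sum_l y i l * A l j));
  last by apply/funext => y; rewrite mxE.
apply: continuous_at_sum => l _; apply: continuousM; last exact: cst_continuous.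
exact: coord_continuous.
Qed.

Lemma continuous_near_eq (S T : topologicalType) (f g : S -> T) x :
  (\forall z \near x, f z = g z) -> {for x, continuous f} -> {for x, continuous g}.
Proof.
move=> fg cf; rewrite /prop_for /continuous_at -(nbhs_singleton fg).
by apply: cvg_trans cf; exact: near_eq_cvg.
Qed.

Section SmoothNear.
Context {n : nat} {W : normedModType R}.
Implicit Types (f g : 'rV[R]_n -> W) (x y : 'rV[R]_n).

Lemma iter_partial_near f g y s :
  (\forall z \near y, f z = g z) -> (\forall z \near y, iter_partial s f z = iter_partial s g z).
Proof.
elim: s y => [//|i s IHs] y fg /=.
apply: filterS (nbhs_interior fg) => y' fg'.
by apply: near_eq_derive; exact: IHs.
Qed.

Lemma smooth_near_eq f g y :
  (\forall z \near y, f z = g z) -> smooth_near f y -> smooth_near g y.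
Proof.
move=> fg sf; move: (nbhs_interior fg) sf; apply: filterS2 => y' fg' sf s.
have [cf df] := sf s; split.
  by apply: continuous_near_eq cf; exact: iter_partial_near.
by move=> i; apply: near_eq_derivable (df i); exact: iter_partial_near.
Qed.

Lemma smooth_near_continuous f y : smooth_near f y -> {for y, continuous f}.
Proof. by move=> /nbhs_singleton /(_ [::])[]. Qed.

Lemma is_derive_affine (A : {linear 'rV[R]_n -> W}) (c : W) x v :
  is_derive x v (fun y => A y + c) (A v).
Proof.
have E : \forall h \near (0 : R)^',
    h^-1 *: (((fun y => A y + c) \o shift x) (h *: v) - (A x + c)) = A v.
  near=> h; rewrite /= (linearD A) (linearZ_LR A) /= -(addrA (h *: A v)) addrK.
  by rewrite scalerA mulVf ?scale1r//; near: h; exact: nbhs_dnbhs_neq.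
by split; [exact: (is_cvg_near_cst (A v))|exact: (lim_near_cst _ (l := A v))].
Unshelve. all: by end_near. Qed.

(** First partial derivatives are constant and later ones vanish, so every nonempty word of partials
    yields a constant function. *)
Lemma smooth_near_affine (A : {linear 'rV[R]_n -> W}) (c : W) y :
  continuous A -> smooth_near (fun x => A x + c) y.
Proof.
move=> cA.
have cstP s : s != [::] -> exists w, iter_partial s (fun x => A x + c) = cst w.
  elim: s => [//|i s IHs] _ /=; have [->|/IHs [w ->]] := eqVneq s [::].
    exists (A (basis_vec R i)); apply/funext => x.
    by have [_] := is_derive_affine A c x (basis_vec R i).
  by exists 0; apply/funext => x; rewrite derive_cst.
near=> y' => s; case: (eqVneq s [::]) => [->|/cstP[w ->]].
  split=> [|i]; last by have [] := is_derive_affine A c y' (basis_vec R i).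
  by apply: continuousD; [exact: cA|exact: cst_continuous].
by split=> [|i]; [exact: cst_continuous|exact: derivable_cst].
Unshelve. all: by end_near. Qed.

Lemma derive_comp_linear m (L : {linear 'rV[R]_m -> 'rV[R]_n}) f (x v : 'rV[R]_m) :
  'D_v (f \o L) x = 'D_(L v) f (L x).
Proof.
by rewrite /derive; under eq_fun do rewrite /= (linearD L) (linearZ_LR L) /=.
Qed.

Lemma derivable_comp_linear m (L : {linear 'rV[R]_m -> 'rV[R]_n}) f (x v : 'rV[R]_m) :
  derivable f (L x) (L v) -> derivable (f \o L) x v.
Proof.
by rewrite /derivable; under [X in _ -> cvg (X @ _)]eq_fun do rewrite /= (linearD L) (linearZ_LR L) /=.
Qed.

(** The condition on basis vectors makes each iterated partial of [f \o L] either an iterated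
    partial of [f] composed with [L] or zero, which avoids sums over directions. Coordinate
    projections satisfy it. *)
Lemma smooth_near_comp_linear m (L : {linear 'rV[R]_m -> 'rV[R]_n}) f (y : 'rV[R]_m) :
  continuous L ->
  (forall i, (exists j, L (basis_vec R i) = basis_vec R j) \/ L (basis_vec R i) = 0) ->
  smooth_near f (L y) -> smooth_near (f \o L) y.
Proof.
move=> cL basisL sf.
have iterE s : (exists s', iter_partial s (f \o L) = iter_partial s' f \o L) \/
    iter_partial s (f \o L) = cst 0.
  elim: s => [|i s [[s' /= ->]|/= ->]]; first by left; exists [::].
    have [[j Lj]|Li0] := basisL i.
      left; exists (j :: s'); apply/funext => x.
      by rewrite derive_comp_linear Lj.
    by right; apply/funext => x; rewrite derive_comp_linear Li0 derive0.
  by right; apply/funext => x; rewrite derive_cst.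
have := cL y _ sf; rewrite /= nbhs_simpl /=; apply: filterS => y' sf' s.
have [[s' ->]|->] := iterE s; last first.
  by split=> [|i]; [exact: cst_continuous|exact: derivable_cst].
have [cs' ds'] := sf' s'; split=> [|i].
  by apply: continuous_comp; [exact: cL|exact: cs'].
apply: derivable_comp_linear.
by have [[j ->]|->] := basisL i; [exact: ds'|exact: derivable0].
Qed.

End SmoothNear.

Section Components.
Context {n k : nat}.
Implicit Types (f : 'rV[R]_n -> 'rV[R]_k) (x y : 'rV[R]_n).

Definition component f (j : 'I_k) : 'rV[R]_n -> R^o := fun x => f x 0 j.

Lemma derive_component f j x v :
  derivable f x v -> 'D_v f x 0 j = 'D_v (component f j) x.
Proof. by move=> df; rewrite derive_mx// mxE. Qed.

(** A directional derivative is computed entrywise only where it exists, so the iterated partials of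
    [f] and of its components are matched on neighbourhoods, never globally. *)
Lemma smooth_near_component f y :
  smooth_near f y <-> forall j, smooth_near (component f j) y.
Proof.
split=> [|sf].
  move=> /nbhs_interior sf j; apply: filterS (nbhs_interior sf) => y' sf'.
  have E s : \forall z \near y', iter_partial s f z 0 j = iter_partial s (component f j) z.
    elim: s => [|i s IHs]; first by near=> x.
    apply: filterS2 (nbhs_interior sf') (nbhs_interior IHs) => x /nbhs_singleton sx E /=.
    by rewrite -(near_eq_derive _ E) -derive_component//; have [_ /(_ i)] := nbhs_singleton sx s.
  move=> s; have [cs ds] := nbhs_singleton (nbhs_singleton sf') s; split=> [|i].
    apply: continuous_near_eq (E s) _.
    by move/continuous_mxP: cs; exact.
  apply: (near_eq_derivable (E s)).
  by move/derivable_mxP: (ds i); exact.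
have {}sf : \forall y' \near y, forall j s, 
    {for y', continuous (iter_partial s (component f j))} /\
    forall i : 'I_n, derivable (iter_partial s (component f j)) y' (basis_vec R i).
  exact: (@filter_forall _ 'I_k (fun j y' => forall s,
    {for y', continuous (iter_partial s (component f j))} /\
    forall i : 'I_n, derivable (iter_partial s (component f j)) y' (basis_vec R i)) _ _ sf).
apply: filterS (nbhs_interior sf) => y' sf'.
have E s : \forall z \near y', \row_j iter_partial s (component f j) z = iter_partial s f z.
  elim: s => [|i s IHs].
    by near=> x; apply/rowP => j; rewrite mxE.
  apply: filterS2 sf' (nbhs_interior IHs) => x sx E /=.
  rewrite -(near_eq_derive _ E) derive_mx; last first.
    apply/derivable_mxP => a j; have [_ /(_ i)] := sx j s.
    by apply: near_eq_derivable; near=> z; rewrite mxE.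
  apply/matrixP => a j; rewrite !mxE; apply: near_eq_derive.
  by near=> z; rewrite mxE.
move=> s; have {}sf' := nbhs_singleton sf'; split=> [|i].
  apply: continuous_near_eq (E s) _; apply/continuous_mxP => a j.
  have [+ _] := sf' j s.
  by apply: continuous_near_eq; near=> z; rewrite mxE.
apply: (near_eq_derivable (E s)); apply/derivable_mxP => a j.
have [_ /(_ i)] := sf' j s.
by apply: near_eq_derivable; near=> z; rewrite mxE.
Unshelve. all: by end_near. Qed.

End Components.

Lemma smooth_near_row_mx n k l (f : 'rV[R]_n -> 'rV[R]_k) (g : 'rV[R]_n -> 'rV[R]_l) y :
  smooth_near f y -> smooth_near g y ->
  smooth_near (fun x => row_mx (f x) (g x)) y.
Proof.
move=> /smooth_near_component sf /smooth_near_component sg.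
apply/smooth_near_component => j; rewrite -(splitK j) /component.
case: (fintype.split j) => a /=.
  by under eq_fun do rewrite row_mxEl; exact: sf.
by under eq_fun do rewrite row_mxEr; exact: sg.
Qed.

Lemma basis_vec_submx n1 n2 (i : 'I_(n1 + n2)) :
  ((exists j, lsubmx (basis_vec R i) = basis_vec R j) \/ lsubmx (basis_vec R i) = 0) /\
  ((exists j, rsubmx (basis_vec R i) = basis_vec R j) \/ rsubmx (basis_vec R i) = 0).
Proof.
rewrite -(splitK i); case: (fintype.split i) => a /=; split.
- left; exists a; apply/rowP => j; rewrite !mxE /=.
  by rewrite (inj_eq (@lshift_inj _ _)).
- by right; apply/rowP => j; rewrite !mxE /= eq_rlshift.
- by right; apply/rowP => j; rewrite !mxE /= eq_lrshift.
- left; exists a; apply/rowP => j; rewrite !mxE /=.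
  by rewrite (inj_eq (@rshift_inj _ _)).
Qed.

Lemma smooth_near_lsubmx n1 n2 (W : normedModType R) (f : 'rV[R]_n1 -> W) (y : 'rV[R]_(n1 + n2)) :
  smooth_near f (lsubmx y) -> smooth_near (f \o lsubmx) y.
Proof.
apply: smooth_near_comp_linear; first exact: continuous_lsubmx.
by move=> i; have [] := basis_vec_submx i.
Qed.

Lemma smooth_near_rsubmx n1 n2 (W : normedModType R) (f : 'rV[R]_n2 -> W) (y : 'rV[R]_(n1 + n2)) :
  smooth_near f (rsubmx y) -> smooth_near (f \o rsubmx) y.
Proof.
apply: smooth_near_comp_linear; first exact: continuous_rsubmx.
by move=> i; have [] := basis_vec_submx i.
Qed.

Lemma smooth_near_mulmx n k (A : 'M[R]_(n, k)) c y :
  smooth_near (fun x : 'rV[R]_n => x *m A + c) y.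
Proof.
by apply: (smooth_near_affine (A := mulmxr A)); exact: continuous_mulmxr.
Qed.

Lemma smooth_near_id n (y : 'rV[R]_n) : smooth_near id y.
Proof.
apply: smooth_near_eq (smooth_near_mulmx 1%:M 0 y).
by near=> x; rewrite mulmx1 addr0.
Unshelve. all: by end_near. Qed.

Lemma smooth_near_cst n k (c : 'rV[R]_k) (y : 'rV[R]_n) : smooth_near (fun=> c) y.
Proof.
apply: smooth_near_eq (smooth_near_mulmx 0 c y).
by near=> x; rewrite mulmx0 add0r.
Unshelve. all: by end_near. Qed.

End Calculus.

(** * Differentiability and the chain rule *)

Section Differentiability.
Context {R : realType}.

Lemma derive_line n (f : 'rV[R]_n -> R^o) z e (s : R) :
  derivable f (z + s *: e) e ->
  is_derive s 1 (fun t : R => f (z + t *: e) : R^o) ('D_e f (z + s *: e)).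
Proof.
move=> df.
have E : (fun h : R => h^-1 *: (((fun t : R => f (z + t *: e) : R^o) \o shift s) (h *: 1)
    - f (z + s *: e))) =
  (fun h : R => h^-1 *: ((f \o shift (z + s *: e)) (h *: e) - f (z + s *: e))).
  apply/funext => h /=; congr (_ *: (f _ - _)).
  by rewrite [h%:A]mulr1 scalerDl addrCA.
by split; rewrite /derivable /derive E.
Qed.

Lemma MVT_line n (f : 'rV[R]_n -> R^o) z e (t : R) :
  (forall s : R, `|s| <= `|t| -> derivable f (z + s *: e) e) ->
  exists2 s : R, `|s| <= `|t| & f (z + t *: e) - f z = 'D_e f (z + s *: e) * t.
Proof.
move=> df.
have cf (s : R) : `|s| <= `|t| -> {for s, continuous (fun t : R => f (z + t *: e) : R^o)}.
  move=> /df/derive_line[+ _] => /derivable1_diffP.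
  exact: differentiable_continuous.
have wcf a b : (forall s : R, a <= s <= b -> `|s| <= `|t|) ->
    {within `[a, b], continuous (fun t : R => f (z + t *: e) : R^o)}.
  move=> H; apply: continuous_in_subspaceT => s; rewrite inE /= in_itv /= => sab.
  exact/cf/H.
have z0 : z + 0 *: e = z by rewrite scale0r addr0.
have dfa a b : (forall s : R, a <= s <= b -> `|s| <= `|t|) ->
    forall s, s \in `]a, b[%R ->
    is_derive s 1 (fun t : R => f (z + t *: e) : R^o) ('D_e f (z + s *: e)).
  move=> H s; rewrite in_itv /= => /andP[/ltW sa /ltW sb].
  by apply/derive_line/df/H; rewrite sa.
have [t0|t0] := lerP 0 t.
  have lt s : 0 <= s <= t -> `|s| <= `|t|.
    by move=> /andP[s0 st]; rewrite !ger0_norm.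
  have [s + E] := MVT_segment t0 (dfa _ _ lt) (wcf _ _ lt).
  by rewrite in_itv /= => st; exists s; [exact: lt|rewrite z0 subr0 in E].
have lt s : t <= s <= 0 -> `|s| <= `|t|.
  by move=> /andP[s0 st]; rewrite !ler0_norm ?lerN2// ltW.
have [s + E] := MVT_segment (ltW t0) (dfa _ _ lt) (wcf _ _ lt).
rewrite in_itv /= => st; rewrite z0 sub0r in E; exists s; first exact: lt.
by rewrite -opprB E mulrN opprK.
Qed.

Lemma mx_norm_le m n (A : 'M[R]_(m, n)) (c : R) :
  0 <= c -> (forall i j, `|A i j| <= c) -> `|A| <= c.
Proof.
by move=> c0 Ac; rewrite [leLHS]/Num.Def.normr/= mx_normrE; apply: bigmax_le.
Qed.

Lemma le_mx_norm m n (A : 'M[R]_(m, n)) i j : `|A i j| <= `|A|.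
Proof.
rewrite [leRHS]/Num.Def.normr/= mx_normrE.
exact: (le_bigmax _ (fun p : 'I_m * 'I_n => `|A p.1 p.2|) (i, j)).
Qed.

(* f (y + h) - f y is telescoped along the coordinate directions, and the mean
   value theorem is applied to each step. *)
Lemma C1_differentiable n (f : 'rV[R]_n -> R^o) y :
  (\forall z \near y, forall i, derivable f z (basis_vec R i)) ->
  (forall i, {for y, continuous ('D_(basis_vec R i) f)}) ->
  differentiable f y /\
  forall v, 'd f y v = \sum_i v 0 i * 'D_(basis_vec R i) f y.
Proof.
move=> df cf.
pose L (v : 'rV[R]_n) : R^o := \sum_i v 0 i * 'D_(basis_vec R i) f y.
have Llin : linear L.
  move=> a u v; rewrite /L scaler_sumr -big_split /=; apply: eq_bigr => i _.
  by rewrite !mxE /GRing.scale /= mulrDl mulrA.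
pose LL := GRing.isLinear.Build _ _ _ _ L Llin.
pose L' : {linear 'rV[R]_n -> R^o} := HB.pack L LL.
have cL : continuous L'.
  move=> v; apply: continuous_at_sum => i _; apply: continuousM; last exact: cst_continuous.
  exact: coord_continuous.
have E : f \o shift y = cst (f y) + L' +o_ (0 : 'rV[R]_n) id.
  apply/eqaddoP => _/posnumP[e].
  (* Each of the [n] coordinate steps costs at most [d * |h|]; dividing by n + 1 also covers n =
     0. *)
  pose d := e%:num / n.+1%:R.
  have d0 : 0 < d by rewrite divr_gt0.
  have : \forall z \near y, forall i, derivable f z (basis_vec R i) /\
      `|'D_(basis_vec R i) f y - 'D_(basis_vec R i) f z| <= d.
    apply: (@filter_forall _ 'I_n (fun i z => derivable f z (basis_vec R i) /\
        `|'D_(basis_vec R i) f y - 'D_(basis_vec R i) f z| <= d) (nbhs y) _) => i.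
    near=> z; split; first by move: (i); near: z.
    by near: z; exact: (cvgrPdist_le _ _).1 (cf i) _ d0.
  move=> /nbhs_ballP[r /= r0 Hr].
  near=> h.
  have hr : `|h| < r.
    by near: h; apply/nbhs_ballP; exists r => // h; rewrite -ball_normE /= sub0r normrN.
  (* [P k] keeps the first k coordinates of [h], so it runs from 0 to [h] parallel to the axes. *)
  pose P k := \row_(j < n) (if (j < k)%N then h 0 j else 0).
  have PS (i : 'I_n) : P i.+1 = P i + h 0 i *: basis_vec R i.
    apply/rowP => j; rewrite !mxE ltnS; have [->|ji] := eqVneq j i.
      by rewrite leqnn ltnn add0r mulr1.
    by rewrite ltn_neqAle (_ : j != i :> nat)//= mulr0 addr0.
  have step (i : 'I_n) : `|f (y + P i.+1) - f (y + P i) - h 0 i * 'D_(basis_vec R i) f y|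
      <= d * `|h|.
    have Pr (s : R) : `|s| <= `|h 0 i| -> ball y r (y + P i + s *: basis_vec R i).
      move=> sh; rewrite -ball_normE /= -addrA opprD addrA subrr sub0r normrN.
      apply: le_lt_trans hr; apply: mx_norm_le => // a j; rewrite !mxE ord1 eqxx /=.
      have [<-|ji] := eqVneq i j.
        by rewrite ltnn add0r mulr1 (le_trans sh)// le_mx_norm.
      by rewrite mulr0 addr0; case: ifP => _; rewrite ?normr0// le_mx_norm.
    have [s /Pr/Hr/(_ i)[]//|s sh] := @MVT_line _ f (y + P i) (basis_vec R i) (h 0 i).
    rewrite PS addrA => ->; rewrite [h 0 i * _]mulrC -mulrBl normrM.
    apply: ler_pM => //; last exact: le_mx_norm.
    by rewrite distrC; have [_] := Hr _ (Pr _ sh) i.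
  have fE : f (h + y) - f y = \sum_(i < n) (f (y + P i.+1) - f (y + P i)).
    rewrite -(big_mkord xpredT (fun i => f (y + P i.+1) - f (y + P i))) telescope_sumr//.
    have -> : P 0%N = 0 by apply/rowP => j; rewrite !mxE.
    have -> : P n = h by apply/rowP => j; rewrite !mxE ltn_ord.
    by rewrite addr0 [h + y]addrC.
  rewrite -[X in `|X|]/(f (h + y) - (f y + L h)) opprD addrA fE -sumrB.
  apply: le_trans (ler_norm_sum _ _ _) _.
  apply: le_trans (ler_sum _ (fun i _ => step i)) _.
  rewrite sumr_const card_ord -[_ *+ n]mulr_natl mulrA ler_wpM2r// /d.
  by rewrite mulrCA ler_piMr// ler_pdivrMr// mul1r ler_nat.
have dE : 'd f y = L' :> ('rV[R]_n -> R^o) := diff_unique cL E.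
split; last by move=> v; rewrite dE.
by apply/diff_locallyP; rewrite dE.
Unshelve. all: by end_near. Qed.

(** Since [p] is only derivable along [e], the chain rule for differentials is applied to the curve
    [c], for which derivability and differentiability coincide. *)
Lemma is_derive_comp m n (G : 'rV[R]_n -> R^o) (p : 'rV[R]_m -> 'rV[R]_n) q e :
  differentiable G (p q) -> derivable p q e ->
  is_derive q e (G \o p) ('d G (p q) ('D_e p q)).
Proof.
move=> dG dp.
pose c (t : R) := p (t *: e + q).
have c0 : c 0 = p q by rewrite /c scale0r add0r.
have line (W : normedModType R) (f : 'rV[R]_m -> W) :
    (fun h : R => h^-1 *: ((f \o shift q) (h *: e) - f q)) =
    (fun h : R => h^-1 *: (((fun t : R => f (t *: e + q)) \o shift 0) (h *: 1) - f (0 *: e + q))).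
  by apply/funext => h /=; rewrite [h%:A]mulr1 addr0 scale0r add0r.
have {}dp : differentiable c 0.
  by apply/derivable1_diffP; move: dp; rewrite /derivable line.
have -> : 'D_e p q = 'D_1 c (0 : R) by rewrite /derive line.
rewrite -c0 in dG *.
have dGc : differentiable (G \o c) 0 by exact: differentiable_comp.
split; first by have /derivable1_diffP := dGc; rewrite /derivable line.
have -> : 'D_e (G \o p) q = 'D_1 (G \o c) (0 : R) by rewrite /derive line.
by rewrite !deriveE// diff_comp.
Qed.

(** Rows are indexed by the source variables, the transpose of the usual Jacobian: vectors are rows,
    and the chain rule puts the inner map first. *)
Definition jacmx n k (f : 'rV[R]_n -> 'rV[R]_k) (y : 'rV[R]_n) : 'M[R]_(n, k) :=
  \matrix_(i, j) 'D_(basis_vec R i) f y 0 j.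

Lemma jacmx_comp m n k (G : 'rV[R]_n -> 'rV[R]_k) (p : 'rV[R]_m -> 'rV[R]_n) q :
  smooth_near G (p q) -> smooth_near p q ->
  jacmx (G \o p) q = jacmx p q *m jacmx G (p q).
Proof.
move=> sG sp; apply/matrixP => i j.
have dp : derivable p q (basis_vec R i) by have [_] := nbhs_singleton sp [::].
have dG l : differentiable (component G l) (p q) /\ forall v, 
    'd (component G l) (p q) v = \sum_a v 0 a * 'D_(basis_vec R a) (component G l) (p q).
  have sGl : smooth_near (component G l) (p q) by move: l; apply/smooth_near_component.
  apply: C1_differentiable; first by apply: filterS sGl => z /(_ [::])[].
  by move=> a; have [] := nbhs_singleton sGl [:: a].
have dGp l : is_derive q (basis_vec R i) (component (G \o p) l)
    ('d (component G l) (p q) ('D_(basis_vec R i) p q)).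
  by apply: is_derive_comp => //; have [] := dG l.
rewrite mxE derive_component; last first.
  by apply/derivable_mxP => a l; rewrite ord1; have [] := dGp l.
have [_ ->] := dGp j; have [_ ->] := dG j.
rewrite mxE; apply: eq_bigr => a _; rewrite !mxE; congr (_ * _).
by rewrite derive_component//; have [_] := nbhs_singleton sG [::].
Qed.

End Differentiability.

(** * Manifolds with a global chart *)

Lemma rV_second_countable (R : realType) n : @second_countable 'rV[R]_n.
Proof.
pose B (p : 'rV[rat]_n * rat) := ball (map_mx ratr p.1 : 'rV[R]_n) (ratr p.2).
exists (range B); first by apply: sub_countable (card_image_le _ _) (countableP _).
split=> [_ [p _ <-]|x]; first exact: ball_open.
move=> A /nbhs_ballP[e /= e0 eA].
have [q] := @rat_in_itvoo R 0 (e / 2) (divr_gt0 e0 (ltr0n _ 2)).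
rewrite in_itv /= => /andP[q0 qe].
have vP j : exists v : rat, `|x 0 j - ratr v| < ratr q.
  have [|v] := @rat_in_itvoo R (x 0 j - ratr q) (x 0 j + ratr q).
    by rewrite ltrD2l (lt_trans _ q0)// oppr_lt0.
  rewrite in_itv /= => /andP[v1 v2]; exists v.
  by rewrite ltr_distlC v1 v2.
have [v {}vP] := choice vP.
have bvx : ball (map_mx ratr (\row_j v j) : 'rV[R]_n) (ratr q) x.
  by split=> // i j; rewrite !mxE ord1 /ball /= distrC.
exists (B (\row_j v j, q)); first by split=> //; exists (\row_j v j, q).
move=> y bvy; apply: eA; rewrite [e]splitr.
apply: (@ball_triangle _ _ (map_mx ratr (\row_j v j) : 'rV[R]_n)).
  by apply: le_ball (ltW qe) _ _; exact: ball_sym.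
exact: le_ball (ltW qe) _ bvy.
Qed.

Section GlobalChart.
Context {R : realType}.

(** The base, the fibre, the total space, the products and the first jet space used below all have
    such an atlas; openness, continuity and smoothness then transfer to coordinates. *)
Definition global_chart n (M : charted R n) (f : M -> 'rV[R]_n) (g : 'rV[R]_n -> M) :=
  [/\ atlas M = [set Chart setT f], cancel f g & cancel g f].

Section OneChart.
Context {n : nat} {M : charted R n} {f : M -> 'rV[R]_n} {g : 'rV[R]_n -> M}.
Hypothesis fg : global_chart f g.

Lemma global_chartK : cancel f g. Proof. by case: fg. Qed.
Lemma global_chartVK : cancel g f. Proof. by case: fg. Qed.

Lemma global_atlasP c : atlas M c <-> c = Chart setT f.
Proof. by case: fg => ->. Qed.

Lemma open_global_chart (O : set M) : open O <-> open (g @^-1` O).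
Proof.
split=> oO.
  rewrite openE => y Oy; rewrite /interior.
  have := oO (Chart setT f) (proj2 (global_atlasP _) erefl) (g y) I Oy.
  by rewrite /= global_chartVK; apply: filterS => z; apply=> //=; rewrite global_chartVK.
move=> _ /global_atlasP -> x _ Ox /=.
move: oO; rewrite openE => /(_ (f x)); rewrite /preimage /= global_chartK => /(_ Ox).
by rewrite /interior; apply: filterS => y + x' _ e; rewrite -e /= global_chartK.
Qed.

Lemma continuous_global_chart : continuous f.
Proof.
apply/continuousP => A oA; apply/open_global_chart.
by rewrite -comp_preimage (_ : f \o g = id)//; apply/funext => y /=; rewrite global_chartVK.
Qed.

Lemma continuous_global_chartV : continuous g.
Proof. by apply/continuousP => A /open_global_chart. Qed.

Lemma chart_inv_restr (S : set M) x0 y : S (g y) -> chart_inv (Chart S f) x0 y = g y.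
Proof.
move=> Sy; apply: xget_unique => [|x [_ /= <-]]; last by rewrite global_chartK.
by rewrite /= global_chartVK.
Qed.

Lemma chart_inv_global x0 : chart_inv (Chart setT f) x0 = g.
Proof. by apply/funext => y; rewrite chart_inv_restr. Qed.

(** Needed for slice charts: a slice chart of an open set [S] with full slice dimension must have
    its domain inside [S], so the global chart has to be restricted. *)
Lemma compatible_chart_restr (S : set M) : open S -> compatible_chart (Chart S f).
Proof.
move=> oS; split=> [x x' _ _ /= e|_ /global_atlasP ->].
  by rewrite -[x]global_chartK e global_chartK.
have near_f x : S x -> \forall y \near f x, S (g y).
  move=> Sx; have := continuous_global_chartV (x := f x).
  by apply; rewrite global_chartK; apply: open_nbhs_nbhs.
split=> x /= Sx Sx'; split.
- apply: filterS (near_f x Sx) => y Sy; exists (g y); split=> //=.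
  by rewrite global_chartVK.
- apply: smooth_near_eq (smooth_near_id _).
  apply: filterS (near_f x Sx) => y Sy /=.
  by rewrite chart_inv_restr// global_chartVK.
- apply: filterS (near_f x Sx') => y Sy; exists (g y); split=> //=.
  by rewrite global_chartVK.
- apply: smooth_near_eq (smooth_near_id _).
  by near=> y; rewrite /= chart_inv_global global_chartVK.
Unshelve. all: by end_near. Qed.

Lemma is_manifold_global_chart : is_manifold M.
Proof.
split=> [x|_ /global_atlasP ->||].
- by exists (Chart setT f) => //; exact/global_atlasP.
- exact/compatible_chart_restr/openT.
- move=> p q pq; rewrite -[p]global_chartK -[q]global_chartK; congr g.
  apply: norm_hausdorff => A B nA nB.
  have [x [Ax Bx]] := pq _ _ (continuous_global_chart nA) (continuous_global_chart nB).
  by exists (f x).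
have [B cB [oB Bx]] := @rV_second_countable R n.
exists [set f @^-1` b | b in B]; first exact: sub_countable (card_image_le _ _) cB.
split=> [_ [b Bb <-]|x A nA].
  by apply: open_comp (oB _ Bb) => y _; exact: continuous_global_chart.
have [|U [BU Ux] UA] := Bx (f x) (g @^-1` A).
  by apply: continuous_global_chartV; rewrite global_chartK.
exists (f @^-1` U); first by split=> //; exists U.
by move=> y /UA; rewrite /preimage /= global_chartK.
Qed.

Lemma is_submanifold_open (S : set M) : open S -> is_submanifold S.
Proof.
(* With slice dimension [n] no coordinate is required to vanish. *)
move=> oS; exists n => x Sx; exists (Chart S f); split=> //.
  exact: compatible_chart_restr.
move=> x' /= Sx'; split=> // _ i; by rewrite leqNgt ltn_ord.
Qed.

End OneChart.

Lemma continuous_at_global_chart n (N : charted R n) f g (T : topologicalType)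
    (h : T -> N) x : global_chart f g ->
  {for x, continuous h} <-> {for x, continuous (f \o h)}.
Proof.
move=> fg; split=> ch.
  by apply: continuous_comp => //; exact: (continuous_global_chart fg).
have -> : h = g \o (f \o h) by apply/funext => y /=; rewrite (global_chartK fg).
by apply: continuous_comp => //; exact: (continuous_global_chartV fg).
Qed.

Lemma smooth_at_global_chart m n (M : charted R m) (N : charted R n) f g f' g'
    (h : M -> N) x : global_chart f g -> global_chart f' g' ->
  smooth_at h x <-> smooth_near (f' \o h \o g) (f x).
Proof.
move=> fg fg'; split=> [[_ sh]|sh].
  have := sh _ _ (proj2 (global_atlasP fg _) erefl) (proj2 (global_atlasP fg' _) erefl) I I.
  by rewrite (chart_inv_global fg).
split.
  apply/(continuous_at_global_chart _ _ fg').
  have -> : f' \o h = (f' \o h \o g) \o f.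
    by apply/funext => y /=; rewrite (global_chartK fg).
  apply: continuous_comp; first exact: (continuous_global_chart fg).
  exact: smooth_near_continuous.
move=> c c' /(global_atlasP fg) -> /(global_atlasP fg') -> _ _ /=.
by rewrite (chart_inv_global fg).
Qed.

Lemma global_chart_euclid n : @global_chart n (euclid R n) id id.
Proof. by []. Qed.

Lemma global_chart_prod m n (M : charted R m) (N : charted R n) f g f' g' :
  global_chart f g -> global_chart f' g' ->
  @global_chart _ (prod_charted M N) (fun x => row_mx (f x.1) (f' x.2))
    (fun y => (g (lsubmx y), g' (rsubmx y))).
Proof.
move=> fg fg'; split.
- apply/seteqP; split=> [_ [_ [_ [/(global_atlasP fg) -> /(global_atlasP fg') -> ->]]]|_ ->] /=.
    by rewrite setXTT.
  exists (Chart setT f), (Chart setT f'); split; [exact/(global_atlasP fg)|exact/(global_atlasP fg')|].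
  by rewrite /= setXTT.
- by case=> a b /=; rewrite row_mxKl row_mxKr (global_chartK fg) (global_chartK fg').
- by move=> y /=; rewrite (global_chartVK fg) (global_chartVK fg') hsubmxK.
Qed.

End GlobalChart.

(** * Trivial bundles *)

Section Multiindices.
Context {n : nat}.

Lemma mi_order_size r (a : mindex n r) : mi_order a = size (mi_seq a).
Proof.
rewrite size_flatten /shape -map_comp sumnE big_map big_enum /=.
by apply: eq_bigr => i _; rewrite size_nseq.
Qed.

Lemma mi_seq_count r (a : mindex n r) i : count_mem i (mi_seq a) = val a i.
Proof.
rewrite count_flatten -map_comp sumnE big_map big_enum /= (bigD1 i)//= big1 => [|j ji].
  by rewrite addn0 count_nseq /= eqxx mul1n.
by rewrite count_nseq /= (negbTE ji).
Qed.

Lemma mi_seq_inj r : injective (@mi_seq n r).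
Proof.
move=> a b ab; apply/val_inj/ffunP => i; apply/val_inj.
by rewrite /= -!mi_seq_count ab.
Qed.

Lemma mi_seq1 (a : mindex n 1) : mi_seq a = [::] \/ exists i, mi_seq a = [:: i].
Proof.
have : (size (mi_seq a) <= 1)%N by rewrite -mi_order_size; exact: (valP a).
by case: (mi_seq a) => [|i []]; [left|right; exists i|].
Qed.

Definition mi_zero : mindex n 1.
Proof. by exists [ffun=> ord0]; rewrite big1// => i _; rewrite ffunE. Defined.

Lemma mi_one_subproof (i : 'I_n) : (\sum_j [ffun j => inord (j == i) : 'I_2] j <= 1)%N.
Proof.
rewrite (bigD1 i)//= big1 => [|j ji]; rewrite ffunE inordK ?ltnS ?leq_b1// ?eqxx//.
by rewrite (negbTE ji).
Qed.

Definition mi_one (i : 'I_n) : mindex n 1 :=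
  exist (fun a : {ffun 'I_n -> 'I_2} => \sum_j a j <= 1)%N _ (mi_one_subproof i).

Lemma mi_seq_zero : mi_seq mi_zero = [::].
Proof.
apply: size0nil; rewrite -mi_order_size.
by rewrite /mi_order big1// => i _; rewrite ffunE.
Qed.

Lemma mi_seq_one i : mi_seq (mi_one i) = [:: i].
Proof.
have := mi_seq_count (mi_one i) i; rewrite ffunE eqxx inordK//.
have [->//|[j ->] /=] := mi_seq1 (mi_one i).
by have [->|] := eqVneq j i.
Qed.

End Multiindices.

Section TrivialBundle.
Context {R : realType} {n k : nat}.

Definition trivial_bundle : bundle R n k :=
  @Bundle R n k (euclid R n) (euclid R k) ('rV[R]_n * 'rV[R]_k)%type fst
    [set Triv setT snd].
Local Notation X := trivial_bundle.

Definition euclid_chart : chart R (euclid R n) n := Chart setT id.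

Definition trivial_fchart : fchart X :=
  @FChart R n k X euclid_chart (Triv setT snd) (Chart setT id).
Local Notation d0 := trivial_fchart.

Lemma is_fchartP (d : fchart X) : is_fchart d <-> d = d0.
Proof. by case: d => a t b; split=> [[/= -> -> ->]|[-> -> ->]]. Qed.

Lemma global_chart_total : @global_chart R _ (total_space X)
  (fun x => row_mx x.1 x.2) (fun y => (lsubmx y, rsubmx y)).
Proof.
have E : @fc_chart R n k X d0 = Chart setT (fun x => row_mx x.1 x.2).
  by congr Chart; apply/seteqP; split.
split; last 2 first.
- by case=> p y /=; rewrite row_mxKl row_mxKr.
- by move=> y; rewrite hsubmxK.
apply/seteqP; split=> [_ [d /is_fchartP -> <-]|_ ->]; rewrite -?E//.
by exists d0 => //; exact/is_fchartP.
Qed.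

Lemma trivial_is_fibre_bundle : is_fibre_bundle X.
Proof.
split.
- exact: is_manifold_global_chart (global_chart_euclid _).
- exact: is_manifold_global_chart (global_chart_euclid _).
- exact: is_manifold_global_chart global_chart_total.
- by move=> p; exists (Triv setT snd).
move=> _ ->; split=> [|p y _]; first exact: openT.
by exists (p, y); split=> // -[q z] /= [-> ->].
Qed.

(** The natural bundle of [k]-tuples of functions: a diffeomorphism moves the base point and leaves
    the values alone. *)
Definition trivial_lift (phi : loc_diffeo (base X)) (x : total_space X) : total_space X :=
  (phi x.1, x.2).

Lemma trivial_is_natural_bundle : is_natural_bundle trivial_lift.
Proof.
split=> [//|phi x px|phi [p y] px pid|phi psi chi [p y] _ _ _ e|m phi t x].
- apply/(smooth_at_global_chart _ _ global_chart_total global_chart_total).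
  apply: smooth_near_row_mx; last exact: (@smooth_near_rsubmx _ _ _ _ id) (smooth_near_id _).
  apply: (@smooth_near_lsubmx _ _ _ _ phi); rewrite row_mxKl.
  have := ld_smooth px.
  by move/(smooth_at_global_chart _ _ (global_chart_euclid n) (global_chart_euclid n)).
- by rewrite /trivial_lift /= (nbhs_singleton pid).
- by rewrite /trivial_lift /= (nbhs_singleton e).
move=> /nbhs_singleton [_].
have gE := global_chart_prod (@global_chart_euclid R m) (@global_chart_euclid R n).
have gT := global_chart_prod (@global_chart_euclid R m) global_chart_total.
move/(smooth_at_global_chart _ _ gE (global_chart_euclid n)) => sphi.
apply/(smooth_at_global_chart _ _ gT global_chart_total).
apply: smooth_near_row_mx; last first.
  exact: (@smooth_near_rsubmx _ _ _ _ rsubmx) (@smooth_near_rsubmx _ _ _ _ id _ (smooth_near_id _)).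
(* [L] forgets the fibre variable. The parameter and base coordinates keep their numbers, so basis
   vectors go to basis vectors or to 0. *)
pose L (y : 'rV[R]_(m + (n + k))) : 'rV[R]_(m + n) := row_mx (lsubmx y) (lsubmx (rsubmx y)).
have Llin : linear L.
  by move=> a u v; rewrite /L scale_row_mx add_row_mx !linearP.
pose LL := GRing.isLinear.Build _ _ _ _ L Llin.
pose L' : {linear 'rV[R]_(m + (n + k)) -> 'rV[R]_(m + n)} := HB.pack L LL.
have Lidx (a : 'I_(m + n)) : exists2 b : 'I_(m + (n + k)), b = a :> nat &
    forall y, L y 0 a = y 0 b.
  rewrite -(splitK a); case: (fintype.split a) => b /=.
    by exists (lshift _ b) => // y; rewrite row_mxEl mxE.
  exists (rshift m (lshift k b)) => // y; by rewrite row_mxEr !mxE.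
apply: (@smooth_near_eq _ _ _ ((fun y => phi (lsubmx y) (rsubmx y)) \o L')).
  by near=> y; rewrite /= /L row_mxKl row_mxKr.
apply: smooth_near_comp_linear.
- move=> y; apply/continuous_mxP => i a; rewrite ord1.
  have [b _ Lb] := Lidx a.
  apply: (@continuous_near_eq _ _ (fun z : 'rV[R]_(m + (n + k)) => z 0 b)).
    by near=> z; rewrite -Lb.
  exact: coord_continuous.
- move=> i; have [ilt|ige] := ltnP i (m + n).
    left; exists (Ordinal ilt); apply/rowP => a.
    by have [b ba ->] := Lidx a; rewrite !mxE -!val_eqE /= ba.
  right; apply/rowP => a; have [b ba ->] := Lidx a; rewrite !mxE -!val_eqE /= ba.
  by rewrite ltn_eqF// (leq_trans (ltn_ord a)).
by rewrite /= /L row_mxKl row_mxKr row_mxKl.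
Unshelve. all: by end_near. Qed.

End TrivialBundle.

(** * First order jets of a trivial bundle *)

Section Jets.
Context {R : realType} {n k : nat}.
Local Notation X := (@trivial_bundle R n k).
Local Notation d0 := (@trivial_fchart R n k).
Local Notation J := (jet_space X 1).

Definition germ_map (g : germ X) : 'rV[R]_n -> 'rV[R]_k := fun y => (g_sec g y).2.

Lemma sec_repE g : sec_rep d0 g = germ_map g.
Proof.
apply/funext => y; rewrite /sec_rep /= (chart_inv_global (@global_chart_euclid R n)) //.
Qed.

Lemma germ_dom_trivial g : germ_dom d0 g. Proof. by []. Qed.

Lemma germ_map_smooth (g : germ X) : 
  \forall q \near (g_pt g : 'rV[R]_n), smooth_near (germ_map g) q.
Proof.
have sg : \forall q \near (g_pt g : base X), smooth_near (germ_map g) q.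
  apply: filterS (germP g) => q [_].
  move/(smooth_at_global_chart _ _ (@global_chart_euclid R n) global_chart_total).
  move/smooth_near_component => sg; apply/smooth_near_component => j.
  apply: smooth_near_eq (sg (rshift n j)); near=> y.
  by rewrite /component /= row_mxEr.
exact: (continuous_global_chartV (@global_chart_euclid R n) sg).
Unshelve. all: by end_near. Qed.

Lemma germ_sec_fst (g : germ X) : (g_sec g (g_pt g)).1 = g_pt g.
Proof. by have [] := nbhs_singleton (germP g). Qed.

Definition gval (g : germ X) : 'rV[R]_k := germ_map g (g_pt g).
Definition gjac (g : germ X) : 'M[R]_(n, k) := jacmx (germ_map g) (g_pt g).

Lemma mk_germP p (s : 'rV[R]_n -> 'rV[R]_k) : (forall q, smooth_near s q) ->
  \forall q \near (p : base X), @Defs.proj R n k X (q, s q) = q /\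
    smooth_at (fun q : base X => (q, s q) : total_space X) q.
Proof.
move=> ss; near=> q; split=> //.
apply/(smooth_at_global_chart _ _ (@global_chart_euclid R n) global_chart_total).
by apply: smooth_near_row_mx; [exact: smooth_near_id|exact: ss].
Unshelve. all: by end_near. Qed.

(** Every 1-jet has an affine representative; this is the source of the explicit jets [mkjet]. *)
Definition affine_germ p (y : 'rV[R]_k) (D : 'M[R]_(n, k)) : germ X :=
  Germ (mk_germP p (smooth_near_mulmx D (y - p *m D))).

Lemma gval_affine p y D : gval (affine_germ p y D) = y.
Proof. by rewrite /gval /germ_map /= addrC subrK. Qed.

Lemma gjac_affine p y D : gjac (affine_germ p y D) = D.
Proof.
apply/matrixP => i j; rewrite mxE.
have [_ /= ->] := is_derive_affine (mulmxr D) (y - p *m D) p (basis_vec R i).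
by rewrite -rowE mxE.
Qed.

(** Multi-indices of order at most 1 give words with at most one letter, so only the head is
    read. *)
Definition pderiv (y : 'rV[R]_k) (D : 'M[R]_(n, k)) (s : seq 'I_n) :=
  if s is i :: _ then row i D else y.

Lemma partial_at_trivial (a : mindex n 1) g :
  partial_at a d0 g = pderiv (gval g) (gjac g) (mi_seq a).
Proof.
rewrite /partial_at sec_repE /=.
by have [->//|[i ->] /=] := mi_seq1 a; apply/rowP => j; rewrite !mxE.
Qed.

Lemma germ_sec_eq g h :
  g_pt g = g_pt h -> gval g = gval h -> g_sec g (g_pt g) = g_sec h (g_pt h).
Proof.
move=> pe ve; have := germ_sec_fst g; have := germ_sec_fst h.
move: ve; rewrite /gval /germ_map.
by case: (g_sec g _) (g_sec h _) => [a b] [c d] /= -> -> ->; rewrite pe.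
Qed.

Lemma jet_equiv1P g h : jet_equiv 1 g h <->
  [/\ g_pt g = g_pt h, gval g = gval h & gjac g = gjac h].
Proof.
split=> [[pe se H]|[pe ve De]].
  have He := H d0 (proj2 (is_fchartP d0) erefl) (germ_dom_trivial g).
  split=> //; first by rewrite /gval /germ_map /= se.
  apply/row_matrixP => i; have := He (mi_one i).
  by rewrite !partial_at_trivial mi_seq_one.
split=> // [|d /is_fchartP -> _ a]; last by rewrite !partial_at_trivial ve De.
exact: germ_sec_eq.
Qed.

Lemma jet_equiv0P g h : jet_equiv 0 g h <-> g_pt g = g_pt h /\ gval g = gval h.
Proof.
have s0 (a : mindex n 0) : mi_seq a = [::].
  by apply: size0nil; rewrite -mi_order_size; apply/eqP; rewrite -leqn0; exact: (valP a).
split=> [[pe se _]|[pe ve]]; first by rewrite /gval /germ_map /= se.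
split=> // [|d /is_fchartP -> _ a]; last by rewrite /partial_at !sec_repE s0.
exact: germ_sec_eq.
Qed.

Lemma jet_ofP r g h : jet_of r g = jet_of r h :> jet X r <-> jet_equiv r g h.
Proof.
split=> [/eqmodP|H]; first by move=> /asboolP.
by apply/eqmodP/asboolP.
Qed.

Lemma jreprK r (z : jet X r) : jet_of r (jrepr z) = z.
Proof. exact: reprK. Qed.

Lemma jproj_id r (z : jet X r) : jproj r z = z.
Proof. exact: jreprK. Qed.

Definition jval (z : jet X 1) := gval (jrepr z).
Definition jder (z : jet X 1) := gjac (jrepr z).

Lemma jet1_ext (z z' : jet X 1) :
  jbase z = jbase z' -> jval z = jval z' -> jder z = jder z' -> z = z'.
Proof.
move=> pe ve De; rewrite -[z]jreprK -[z']jreprK.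
by apply/jet_ofP/jet_equiv1P.
Qed.

Lemma jet_of1E g : [/\ jbase (jet_of 1 g) = g_pt g, jval (jet_of 1 g) = gval g &
  jder (jet_of 1 g) = gjac g].
Proof. by apply/jet_equiv1P/jet_ofP; rewrite jreprK. Qed.

Lemma jproj0P (z z' : jet X 1) :
  jproj 0 z = jproj 0 z' <-> jbase z = jbase z' /\ jval z = jval z'.
Proof.
by split=> [/jet_ofP/jet_equiv0P|H]; [|apply/jet_ofP/jet_equiv0P].
Qed.

Definition mkjet p y D : J := jet_of 1 (affine_germ p y D).

Lemma jbase_mkjet p y D : jbase (mkjet p y D) = p.
Proof. by have [] := jet_of1E (affine_germ p y D). Qed.
Lemma jval_mkjet p y D : jval (mkjet p y D) = y.
Proof. by have [_ -> _] := jet_of1E (affine_germ p y D); exact: gval_affine. Qed.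
Lemma jder_mkjet p y D : jder (mkjet p y D) = D.
Proof. by have [_ _ ->] := jet_of1E (affine_germ p y D); exact: gjac_affine. Qed.
Definition mkjetE := (jbase_mkjet, jval_mkjet, jder_mkjet).

Lemma mkjetK (z : J) : mkjet (jbase z) (jval z) (jder z) = z.
Proof. by apply: jet1_ext; rewrite mkjetE. Qed.

Definition jvec (p : 'rV[R]_n) (y : 'rV[R]_k) (D : 'M[R]_(n, k)) : 'rV[R]_(jdim n k 1) :=
  row_mx p (mxvec (\matrix_(i < #|{: mindex n 1}|, j < k) pderiv y D (mi_seq (enum_val i)) 0 j)).

Lemma jcoordE (z : J) : jcoord d0 z = jvec (jbase z) (jval z) (jder z).
Proof.
congr row_mx; congr mxvec; apply/matrixP => i j.
by rewrite !mxE partial_at_trivial.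
Qed.

Definition jvec_base (x : 'rV[R]_(jdim n k 1)) : 'rV[R]_n := lsubmx x.
Definition jvec_val (x : 'rV[R]_(jdim n k 1)) : 'rV[R]_k :=
  row (enum_rank mi_zero) (vec_mx (rsubmx x)).
Definition jvec_der (x : 'rV[R]_(jdim n k 1)) : 'M[R]_(n, k) :=
  \matrix_i row (enum_rank (mi_one i)) (vec_mx (rsubmx x)).

Lemma jvec_baseK p y D : jvec_base (jvec p y D) = p.
Proof. exact: row_mxKl. Qed.
Lemma jvec_valK p y D : jvec_val (jvec p y D) = y.
Proof.
rewrite /jvec_val row_mxKr mxvecK; apply/rowP => j.
by rewrite !mxE enum_rankK mi_seq_zero.
Qed.
Lemma jvec_derK p y D : jvec_der (jvec p y D) = D.
Proof.
rewrite /jvec_der row_mxKr mxvecK; apply/matrixP => i j.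
by rewrite !mxE enum_rankK mi_seq_one /= mxE.
Qed.

Lemma jvecK x : jvec (jvec_base x) (jvec_val x) (jvec_der x) = x.
Proof.
rewrite -[RHS]hsubmxK; congr row_mx; rewrite -[RHS]vec_mxK; congr mxvec.
apply/matrixP => i j; rewrite mxE.
have [a0|[l al]] := mi_seq1 (enum_val i).
  have -> : i = enum_rank mi_zero.
    by apply/esym/(canLR enum_valK)/mi_seq_inj; rewrite a0 mi_seq_zero.
  by rewrite enum_rankK mi_seq_zero /= mxE.
have -> : i = enum_rank (mi_one l).
  by apply/esym/(canLR enum_valK)/mi_seq_inj; rewrite al mi_seq_one.
by rewrite enum_rankK mi_seq_one /= rowK mxE.
Qed.

Lemma jvec_inj p y D p' y' D' :
  jvec p y D = jvec p' y' D' -> [/\ p = p', y = y' & D = D'].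
Proof.
move=> e; split; [move/(congr1 jvec_base): e|move/(congr1 jvec_val): e|
  move/(congr1 jvec_der): e]; by rewrite ?jvec_baseK ?jvec_valK ?jvec_derK.
Qed.

Definition jcoordV x : J := mkjet (jvec_base x) (jvec_val x) (jvec_der x).

Lemma global_chart_jet : global_chart (@jcoord R n k X 1 d0 : J -> _) jcoordV.
Proof.
split.
- apply/seteqP; split=> [_ [d /is_fchartP -> <-]|_ ->].
    by congr Chart; apply/seteqP; split.
  exists d0; first exact/is_fchartP.
  by congr Chart; apply/seteqP; split.
- move=> z; rewrite /jcoordV jcoordE jvec_baseK jvec_valK jvec_derK.
  exact: mkjetK.
- by move=> x; rewrite jcoordE !mkjetE jvecK.
Qed.

Lemma jvecD p y D D' : jvec p y D + jvec 0 0 D' = jvec p y (D + D').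
Proof.
rewrite /jvec add_row_mx addr0 -linearD /=; congr row_mx; congr mxvec.
apply/matrixP => i j; rewrite !mxE.
by case: (mi_seq _) => [|l s]; rewrite /= !mxE ?addr0.
Qed.

Lemma pure_power1 (lam : 'rV[R]_n) (w : 'rV[R]_k) :
  pure_power 1 lam w = jvec 0 0 (lam^T *m w).
Proof.
congr row_mx; congr mxvec; apply/matrixP => i j; rewrite !mxE /= mi_order_size.
have [->|[l al]] := mi_seq1 (enum_val i); first by rewrite mxE.
rewrite al /= !mxE big_ord1 mxE; congr (_ * _).
have cnt := mi_seq_count (enum_val i); rewrite al in cnt.
rewrite (bigD1 l)//= big1 => [|m ml]; first by rewrite -cnt /= eqxx mulr1.
by rewrite -cnt /= eq_sym (negbTE ml).
Qed.

End Jets.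

(** * Hyperplanes and principal subspaces *)

Section Hyperplanes.
Context {R : realType} {n : nat}.
Implicit Types (p : euclid R n) (lam mu v : 'rV[R]_n).

(** The value 0 off the atlas, which has a single chart, is forced by [tv_default]. *)
Definition mk_tvec_comp v (c : chart R (euclid R n) n) : 'rV[R]_n :=
  if pselect (c = euclid_chart) then v else 0.

Lemma mk_tvec_compE v : mk_tvec_comp v euclid_chart = v.
Proof. by rewrite /mk_tvec_comp; case: pselect. Qed.

Lemma mk_tvec_compat p v c c' : atlas (euclid R n) c -> atlas (euclid R n) c' ->
  dom c p -> dom c' p ->
  mk_tvec_comp v c' = 'D_(mk_tvec_comp v c) (Defs.coord c' \o chart_inv c p) (Defs.coord c p).
Proof.
move=> -> -> _ _; rewrite (chart_inv_global (global_chart_euclid n)) /=.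
by rewrite mk_tvec_compE derive_id.
Qed.

Lemma mk_tvec_default p v c : ~ (atlas (euclid R n) c /\ dom c p) -> mk_tvec_comp v c = 0.
Proof. by rewrite /mk_tvec_comp; case: pselect => // e; case; rewrite e. Qed.

Definition mk_tvec p v : tvec (euclid R n) :=
  TVec (@mk_tvec_compat p v) (@mk_tvec_default p v).

Definition hyp p lam : set (tvec (euclid R n)) := covector_ker euclid_chart p lam.

Lemma hyp_mk_tvec p lam v : hyp p lam (mk_tvec p v) <-> v *m lam^T = 0.
Proof.
by rewrite /hyp /covector_ker /= mk_tvec_compE; split=> [[]|].
Qed.

Lemma hyp_eqP p lam mu :
  hyp p lam = hyp p mu <-> forall v, v *m lam^T = 0 <-> v *m mu^T = 0.
Proof.
split=> [e v|e]; first by rewrite -!(hyp_mk_tvec p) e.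
by apply/seteqP; split=> v [? /e].
Qed.

Lemma ker_sub_proportional lam mu : lam != 0 ->
  (forall v, v *m lam^T = 0 -> v *m mu^T = 0) -> exists c, mu = c *: lam.
Proof.
move=> /rV0Pn[i li] H; exists (mu 0 i / lam 0 i); apply/rowP => j; rewrite mxE.
(* The test vector e_j - (lam_j / lam_i) e_i lies in the kernel of [lam] and isolates the coordinate
   j of [mu]. *)
have /(congr1 (fun A : 'M[R]_1 => A 0 0)) : 
    (basis_vec R j - (lam 0 j / lam 0 i) *: basis_vec R i) *m mu^T = 0.
  apply: H; rewrite mulmxBl -scalemxAl -!rowE; apply/rowP => a.
  by rewrite !mxE ord1 divfK// subrr.
rewrite mulmxBl -scalemxAl -!rowE !mxE => /eqP; rewrite subr_eq0 => /eqP ->.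
by rewrite mulrAC [RHS]mulrAC [lam 0 j * _]mulrC.
Qed.

Lemma hyp_scale p lam c : c != 0 -> hyp p (c *: lam) = hyp p lam.
Proof.
move=> c0; apply/hyp_eqP => v; rewrite linearZ /= -scalemxAr; split=> [/eqP|->].
  by rewrite scaler_eq0 (negbTE c0) => /eqP.
by rewrite scaler0.
Qed.

Lemma hyp_eq_scale p lam mu : lam != 0 -> mu != 0 -> hyp p lam = hyp p mu ->
  exists2 c, c != 0 & mu = c *: lam.
Proof.
move=> l0 m0 /hyp_eqP H.
have [c E] := ker_sub_proportional l0 (fun v => (H v).1); exists c => //.
by apply: contra_neq m0 => c0; rewrite E c0 scale0r.
Qed.

Lemma is_hyperplaneP p tau : is_hyperplane p tau <-> exists2 lam, lam != 0 & tau = hyp p lam.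
Proof.
split=> [[c [lam [-> _ l0 ->]]]|[lam l0 ->]]; first by exists lam.
by exists euclid_chart, lam.
Qed.

End Hyperplanes.

Section Principal.
Context {R : realType} {n k : nat}.
Local Notation X := (@trivial_bundle R n k).
Local Notation d0 := (@trivial_fchart R n k).
Local Notation J := (jet_space X 1).

Lemma jvec0_linear : linear (@jvec R n k 0 0).
Proof.
move=> a D D'; rewrite /jvec scale_row_mx add_row_mx scaler0 addr0 -linearP.
congr row_mx; congr mxvec; apply/matrixP => i j; rewrite !mxE.
by case: (mi_seq _) => [|l s]; rewrite /= !mxE ?mulr0 ?addr0.
Qed.

HB.instance Definition _ := GRing.isLinear.Build _ _ _ _ (@jvec R n k 0 0) jvec0_linear.

Lemma jvecE p y (D : 'M[R]_(n, k)) : jvec p y D = jvec p y 0 + jvec 0 0 D.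
Proof. by rewrite jvecD add0r. Qed.

Lemma jvec0Z a (D : 'M[R]_(n, k)) : jvec 0 0 (a *: D) = a *: jvec 0 0 D.
Proof. by rewrite linearZ. Qed.

(** As the weights sum to 1, the common base point and value survive: convex geometry in a slice
    becomes that of the differentials. *)
Lemma jvec_affine_comb m (t : 'I_m -> R) p y (D : 'I_m -> 'M[R]_(n, k)) :
  \sum_i t i = 1 ->
  \sum_i t i *: jvec p y (D i) = jvec p y (\sum_i t i *: D i).
Proof.
move=> t1; rewrite jvecE linear_sum /=.
under eq_bigr do rewrite jvecE scalerDr.
rewrite big_split /= -scaler_suml t1 scale1r; congr (_ + _).
by apply: eq_bigr => i _; rewrite linearZ.
Qed.

Lemma principalP (z z' : J) (lam : 'rV[R]_n) : lam != 0 ->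
  @principal R n k X 1 (hyp (jbase z) lam) z z' <->
  exists w, z' = mkjet (jbase z) (jval z) (jder z + lam^T *m w).
Proof.
move=> l0; split=> [[d [mu [w [/is_fchartP -> _ _ m0 [e]]]]]|[w ->]]; last first.
  exists d0, lam, w; split=> //.
  by split=> //; rewrite !jcoordE !mkjetE pure_power1 jvecD.
have [c c0 mE] := hyp_eq_scale l0 m0 e.
rewrite !jcoordE pure_power1 jvecD => /jvec_inj[pe ye De].
exists (c *: w); apply: jet1_ext; rewrite mkjetE// De mE.
by rewrite linearZ /= -scalemxAl scalemxAr.
Qed.

End Principal.

(** * Rank one differentials *)

Lemma sum_ord2 (V : nmodType) (F : 'I_2 -> V) : \sum_(i < 2) F i = F 0 + F 1.
Proof. by rewrite big_ord_recl big_ord1; congr (_ + F _); apply/val_inj. Qed.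

Lemma ord2_case (P : 'I_2 -> Prop) : P 0 -> P 1 -> forall i, P i.
Proof.
move=> P0 P1 [[|[|//]] i2]; [have -> : Ordinal i2 = 0 by apply/val_inj|
  have -> : Ordinal i2 = 1 by apply/val_inj]; by [].
Qed.

Lemma addmxE (V : nmodType) m n (A B : 'M[V]_(m, n)) i j : (A + B) i j = A i j + B i j.
Proof. by rewrite mxE. Qed.

Lemma scalemxE (S : pzRingType) m n a (A : 'M[S]_(m, n)) i j : (a *: A) i j = a * A i j.
Proof. by rewrite mxE. Qed.

Section Wedge.
Context {R : realType} {k : nat}.
Implicit Types (D F G : 'M[R]_(2, k)) (lam : 'rV[R]_2) (w : 'rV[R]_k).

(** Entry (i, j) is dF_i /\ dG_j on the standard basis. For [F = G = D] these are the 2 x 2 minors,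
    so [wedge D D != 0] says that [D] has rank 2; distinct arguments serve to compare a jet with a
    formal solution. *)
Definition wedge F G : 'M[R]_k := (row 0 F)^T *m row 1 G - (row 1 F)^T *m row 0 G.

Lemma wedgeE F G i j : wedge F G i j = F 0 i * G 1 j - F 1 i * G 0 j.
Proof. by rewrite !mxE !big_ord1 !mxE. Qed.

(* The image under D of the vector (- lam_1, lam_0) spanning the kernel of lam. *)
Definition restr lam D : 'rV[R]_k := lam 0 0 *: row 1 D - lam 0 1 *: row 0 D.

Lemma restrE lam D j : restr lam D 0 j = lam 0 0 * D 1 j - lam 0 1 * D 0 j.
Proof. by rewrite !mxE. Qed.

Lemma restr0l D : restr 0 D = 0.
Proof. by rewrite /restr !mxE !scale0r subrr. Qed.

Lemma restr_linear lam c mu D :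
  restr (lam + c *: mu) D = restr lam D + c *: restr mu D.
Proof. by apply/rowP => j; rewrite restrE [RHS]addmxE [X in _ = _ + X]scalemxE !restrE !mxE; ring. Qed.

Lemma pure_tensorE lam w i j : (lam^T *m w) i j = lam 0 i * w 0 j.
Proof. by rewrite mxE big_ord1 mxE. Qed.

Lemma restr_principal lam D w : restr lam (D + lam^T *m w) = restr lam D.
Proof.
by apply/rowP => j; rewrite !restrE !addmxE !pure_tensorE; ring.
Qed.

Lemma rV2_neq0 lam : lam != 0 -> lam 0 0 != 0 \/ lam 0 1 != 0.
Proof. by move=> /rV0Pn[]; apply: ord2_case; [left|right]. Qed.

Lemma restr_eq0 lam D : lam != 0 -> restr lam D = 0 -> exists w, D = lam^T *m w.
Proof.
move=> l0 /rowP D0; have {}D0 j : lam 0 0 * D 1 j = lam 0 1 * D 0 j.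
  by apply/eqP; rewrite -subr_eq0 -restrE D0 mxE.
have [l|l] := rV2_neq0 l0.
  exists ((lam 0 0)^-1 *: row 0 D); apply/matrixP => i j.
  rewrite pure_tensorE !mxE; move: i; apply: ord2_case; first by rewrite mulVKf.
  by rewrite mulrCA -D0 mulKf.
exists ((lam 0 1)^-1 *: row 1 D); apply/matrixP => i j.
rewrite pure_tensorE !mxE; move: i; apply: ord2_case; last by rewrite mulVKf.
by rewrite mulrCA D0 mulKf.
Qed.

Lemma wedge_pure_tensor F lam w : wedge F (lam^T *m w) = - ((restr lam F)^T *m w).
Proof.
apply/matrixP => i j; rewrite wedgeE !pure_tensorE.
by rewrite [RHS]mxE [in RHS]mxE big_ord1 [in RHS]mxE restrE; ring.
Qed.

Lemma wedge_pure_tensor_self lam w : wedge (lam^T *m w) (lam^T *m w) = 0.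
Proof. by apply/matrixP => i j; rewrite wedgeE !pure_tensorE mxE; ring. Qed.

Lemma sqnorm_rV2_gt0 lam : lam != 0 -> 0 < lam 0 0 ^+ 2 + lam 0 1 ^+ 2.
Proof.
move=> /rV2_neq0[l|l].
  by rewrite ltr_pwDl ?sqr_ge0// exprn_even_gt0.
by rewrite ltr_wpDl ?sqr_ge0// exprn_even_gt0.
Qed.

(** If [D] had rank at most one, its image would be the line of [D v], with [v] spanning the kernel
    of [lam]. A form [phi] vanishing on [D v] would then vanish on the whole image, in particular on
    that of the vector [lam]. *)
Lemma wedge_neq0 lam D (phi : 'cV[R]_k) : lam != 0 -> restr lam D != 0 ->
  restr lam D *m phi = 0 -> lam *m D *m phi != 0 -> wedge D D != 0.
Proof.
move=> l0 rD0 rphi cphi; apply: contra_neq cphi => /matrixP WD.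
apply/eqP; apply: contraNT rD0 => cphi.
pose p0 := (row 0 D *m phi) 0 0; pose p1 := (row 1 D *m phi) 0 0.
have lp : lam 0 0 * p1 = lam 0 1 * p0.
  apply/eqP; rewrite -subr_eq0 /p0 /p1; move: rphi.
  by rewrite /restr mulmxBl -!scalemxAl => /rowP/(_ 0); rewrite !mxE => ->.
have cp : lam 0 0 * p0 + lam 0 1 * p1 != 0.
  apply: contraNneq cphi => c0; apply/eqP/rowP => i; rewrite ord1.
  have -> : lam *m D = lam 0 0 *: row 0 D + lam 0 1 *: row 1 D.
    by apply/rowP => j; rewrite mxE sum_ord2 !mxE.
  by rewrite mulmxDl -!scalemxAl !mxE -[RHS]c0 /p0 /p1 !mxE.
have W j : p0 * D 1 j = p1 * D 0 j.
  apply/eqP; rewrite -subr_eq0 /p0 /p1 !mxE !mulr_suml -sumrB.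
  rewrite big1// => l _; rewrite !mxE.
  by have := WD l j; rewrite wedgeE mxE => e; rewrite -[RHS](mul0r (phi l 0)) -e; ring.
apply/eqP/rowP => j; rewrite restrE mxE; apply: (mulfI cp); rewrite mulr0.
(* The minor of the columns [D *m phi] and [col j D], computed in the orthogonal basis formed by
   [lam] and (- lam_1, lam_0), whose determinant is |lam|^2. *)
have -> : (lam 0 0 * p0 + lam 0 1 * p1) * (lam 0 0 * D 1 j - lam 0 1 * D 0 j) =
  (lam 0 0 ^+ 2 + lam 0 1 ^+ 2) * (p0 * D 1 j - p1 * D 0 j) +
  (lam 0 0 * p1 - lam 0 1 * p0) * (lam 0 0 * D 0 j + lam 0 1 * D 1 j) by ring.
by rewrite W lp !subrr mulr0 mul0r addr0.
Qed.

End Wedge.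

Section AmpleAlong.
Context {R : realType}.

(** Two linear conditions on a form in three variables: this is where the target dimension 3
    enters. *)
Lemma common_annihilator (x y : 'rV[R]_3) :
  exists phi : 'cV[R]_3, [/\ phi != 0, x *m phi = 0 & y *m phi = 0].
Proof.
pose A := (col_mx x y)^T : 'M[R]_(3, 1 + 1).
have : kermx A != 0.
  rewrite -mxrank_eq0 mxrank_ker -lt0n subn_gt0.
  exact: leq_ltn_trans (rank_leq_col A) _.
case/rowV0Pn => v /sub_kermxP vA v0.
exists v^T; have : col_mx x y *m v^T = 0 by apply: trmx_inj; rewrite trmx_mul trmxK vA trmx0.
rewrite mul_col_mx -[0]vsubmxK => /eq_col_mx[-> ->].
by rewrite !linear0 trmx_eq0.
Qed.

Lemma functional_surj k (phi : 'cV[R]_k) (t : R) : phi != 0 -> exists e : 'rV[R]_k, e *m phi = t%:M.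
Proof.
move=> /cV0Pn[i phi0]; exists ((t / phi i 0) *: delta_mx 0 i).
rewrite -scalemxAl -rowE; apply/rowP => j; rewrite !mxE ord1 eqxx mulr1n.
by rewrite divfK.
Qed.

End AmpleAlong.

(** * Ampleness *)

Section AmpleAlong.
Context {R : realType}.
Local Notation X := (@trivial_bundle R 2 3).
Local Notation d0 := (@trivial_fchart R 2 3).
Local Notation J := (jet_space X 1).
Implicit Types (C : set J) (p : 'rV[R]_2) (lam : 'rV[R]_2).

(* A linear form phi annihilating both the kernel direction restr lam F and the
   image of x is nonzero along the open segment from x to any w with
   phi w != phi x, so the segment consists of immersive jets. *)
Lemma ample_along_immersive C p lam : lam != 0 ->
  (forall z : J, jbase z = p -> wedge (jder z) (jder z) != 0 -> C z) ->
  (forall z : J, C z -> jbase z = p -> restr lam (jder z) != 0) ->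
  ample_along C (@jproj _ _ _ X 1 1 : J -> J) p (hyp p lam).
Proof.
move=> l0 Cimm Crestr; have -> : (@jproj _ _ _ X 1 1 : J -> J) = id.
  by apply/funext => z; exact: jproj_id.
move=> F CF /= Fp d /is_fchartP -> _; rewrite -Fp in Cimm Crestr *.
pose G w : J := mkjet (jbase F) (jval F) (jder F + lam^T *m w).
have PG w : @principal R 2 3 X 1 (hyp (jbase F) lam) F (G w).
  by apply/principalP => //; exists w.
have Gcoord w : jcoord d0 (G w) = jvec (jbase F) (jval F) (jder F + lam^T *m w).
  by rewrite jcoordE !mkjetE.
move=> x [Cx /(principalP _ _ l0)[wx xE]]; rewrite {x}xE in Cx * => /=.
apply/seteqP; split=> [h [m [t [y [t0 t1 yP ->]]]]|_ [_ /(principalP _ _ l0)[w ->] <-]].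
  (* Endpoints of paths lie in the principal subspace, which is affine, so the hull does not leave
     it. *)
  have /choice[w yw] : forall i, exists w, y i = jcoord d0 (G w).
    move=> i; have [z [gam [_ _ g1 gP]] <-] := yP i.
    have : 0 <= (1 : R) <= 1 by rewrite ler01 lexx.
    by move=> /gP; rewrite g1 => -[_ /(principalP _ _ l0)[w ->]]; exists w.
  exists (G (\sum_i t i *: w i)); first exact: PG.
  rewrite Gcoord; under [RHS]eq_bigr do rewrite yw Gcoord.
  rewrite jvec_affine_comb//; congr jvec.
  under [RHS]eq_bigr do rewrite scalerDr scalemxAr.
  by rewrite big_split /= -scaler_suml t1 scale1r -mulmx_sumr.
have rx := Crestr _ Cx (jbase_mkjet _ _ _).
rewrite mkjetE restr_principal in rx.
have [phi [phi0 uphi cphi]] := common_annihilator (restr lam (jder F)) (lam *m (jder F + lam^T *m wx)).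
pose N := (lam *m lam^T) 0 0.
have N0 : N != 0 by rewrite /N mxE sum_ord2 !mxE -!expr2 gt_eqF// sqnorm_rV2_gt0.
have reach w' : (w' - wx) *m phi != 0 ->
    path_comp R (C `&` [set z | @principal R 2 3 X 1 (hyp (jbase F) lam) F z]) (G wx) (G w').
  move=> w'phi; exists (fun s => G (wx + s *: (w' - wx))); split.
  - apply: continuous_subspaceT => s.
    apply/(continuous_at_global_chart _ _ global_chart_jet).
    have E (r : R) : jvec (jbase F) (jval F) (jder F + lam^T *m wx) + 
        r *: jvec 0 0 (lam^T *m (w' - wx)) = jcoord d0 (G (wx + r *: (w' - wx))).
      by rewrite Gcoord mulmxDr addrA -scalemxAr -[RHS]jvecD jvec0Z.
    apply: (@continuous_near_eq _ _ (fun r : R =>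
        jvec (jbase F) (jval F) (jder F + lam^T *m wx) + r *: jvec 0 0 (lam^T *m (w' - wx)))).
      by near=> r; exact: E.
    apply: continuousD; first exact: cst_continuous.
    exact: scalel_continuous.
  - by rewrite scale0r addr0.
  - by rewrite scale1r addrC subrK.
  move=> s /andP[s0 s1]; split; last exact: PG.
  (* The starting jet is in [C] but may fail to be immersive, so s = 0 is treated apart. *)
  have [->|sn0] := eqVneq s 0; first by rewrite scale0r addr0.
  apply: Cimm; rewrite !mkjetE//.
  apply: (wedge_neq0 l0 (phi := phi)); rewrite ?restr_principal//.
  have -> : lam *m (jder F + lam^T *m (wx + s *: (w' - wx))) *m phi =
      (s * N) *: ((w' - wx) *m phi).
    rewrite mulmxDr addrA mulmxDr mulmxDl cphi add0r -scalemxAr -scalemxAr.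
    by rewrite -scalemxAl mulmxA [lam *m lam^T]mx11_scalar -/N mul_scalar_mx -scalemxAl scalerA.
  by rewrite scaler_eq0 mulf_eq0 (negbTE sn0) (negbTE N0).
(* [phi e] exceeds |phi (w - wx)|, so at both [w + e] and [w - e] the form [phi] differs from its
   value at [wx]. Both points are reachable and [w] is their midpoint. *)
have [e ephi] := functional_surj (`|((w - wx) *m phi) 0 0| + 1) phi0.
have sep (s : bool) : (w + (-1) ^+ s *: e - wx) *m phi != 0.
  apply/eqP => /rowP/(_ 0); rewrite addrAC mulmxDl -scalemxAl ephi addmxE !mxE eqxx mulr1n.
  set a := \sum_i _; move: (ler_norm a) (ler_norm (- a)); rewrite normrN.
  by case: s; rewrite ?expr1 ?expr0; lra.
exists 2%N, (fun=> 1 / 2), (fun i => jcoord d0 (G (w + (-1) ^+ (val i == 0%N) *: e))); split.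
- by move=> i; rewrite divr_ge0.
- by rewrite sum_ord2 -splitr.
- by move=> i; exists (G (w + (-1) ^+ (val i == 0%N) *: e)) => //; exact/reach/sep.
under eq_bigr do rewrite Gcoord.
rewrite Gcoord jvec_affine_comb; last by rewrite sum_ord2 -splitr.
rewrite sum_ord2 /= expr1 expr0; congr jvec.
rewrite !mulmxDr -!scalemxAr; set A := lam^T *m w; set B := lam^T *m e.
by apply/matrixP => i j; rewrite !mxE; lra.
Unshelve. all: by end_near. Qed.

End AmpleAlong.

(** * Continuity and sign lemmas for functions on the jet space *)

Lemma open_neq0_fun (R : realType) (T : topologicalType) (f : T -> R) :
  continuous f -> open [set x | f x != 0].
Proof. by move=> /continuousP cf; have := cf _ (@open_neq R 0). Qed.

Lemma continuous_at_sub (R : realType) (T : topologicalType) (f g : T -> R) x :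
  {for x, continuous f} -> {for x, continuous g} -> {for x, continuous (fun z => f z - g z)}.
Proof. exact: (@continuousB R R^o T f g x). Qed.

Lemma mulr_le0_min_max (R : realType) (a b : R) :
  a * b <= 0 -> Num.min a b <= 0 <= Num.max a b.
Proof.
rewrite ge_min le_max; case: (lerP a 0) => a0; case: (lerP b 0) => b0 ab /=.
- apply: contraT; rewrite negb_or -!ltNge => /andP[a0' b0'].
  by move: ab; rewrite leNgt nmulr_rgt0// b0'.
- by rewrite (ltW b0) orbT.
- by rewrite (ltW a0).
- by move: ab; rewrite leNgt mulr_gt0.
Qed.

Lemma ord3_case (P : 'I_3 -> Prop) : P 0 -> P 1 -> P ord_max -> forall i, P i.
Proof.
move=> P0 P1 P2 [[|[|[|//]]] i3].
- by have -> : Ordinal i3 = 0 by apply/val_inj.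
- by have -> : Ordinal i3 = 1 by apply/val_inj.
by have -> : Ordinal i3 = ord_max by apply/val_inj.
Qed.

Section JetContinuity.
Context {R : realType} {n k : nat}.
Local Notation X := (@trivial_bundle R n k).
Local Notation J := (jet_space X 1).

Lemma jder_continuous i j : continuous (fun z : J => jder z i j).
Proof.
pose c (x : 'rV[R]_(jdim n k 1)) := x 0 (rshift n (mxvec_index (enum_rank (mi_one i)) j)).
have -> : (fun z : J => jder z i j) = c \o @jcoord R n k X 1 (@trivial_fchart R n k).
  have cE x : c x = jvec_der x i j by rewrite !mxE.
  by apply/funext => z /=; rewrite cE jcoordE jvec_derK.
move=> z; apply: (@continuous_comp _ _ _ _ c); last exact: coord_continuous.
exact: (continuous_global_chart global_chart_jet).
Qed.

Lemma jbase_continuous : continuous (@jbase R n k X 1 : J -> euclid R n).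
Proof.
move=> z; apply/(continuous_at_global_chart _ _ (global_chart_euclid n)).
have -> : id \o (@jbase R n k X 1 : J -> euclid R n) = 
    lsubmx \o @jcoord R n k X 1 (@trivial_fchart R n k).
  by apply/funext => z' /=; rewrite row_mxKl.
apply: continuous_comp; last exact: continuous_lsubmx.
exact: (continuous_global_chart global_chart_jet).
Qed.

End JetContinuity.

(** * The relation and its failure of ampleness *)

Section Relation.
Context {R : realType}.
Local Notation X := (@trivial_bundle R 2 3).
Local Notation d0 := (@trivial_fchart R 2 3).
Local Notation J := (jet_space X 1).
Implicit Types (D : 'M[R]_(2, 3)) (p lam : 'rV[R]_2).

(* For a map (x, y, z) : R^2 -> R^3 with differential D, this says that dz or
   dx /\ dy is nonzero. *)
Definition admissible D :=
  [|| D 0 ord_max != 0, D 1 ord_max != 0 | wedge D D 0 1 != 0].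

Definition relation : set J := [set z | admissible (jder z)].

(** If both z-partials and the minor of dx and dy vanish, so do all minors: those meeting the last
    column are zero and the remaining block is antisymmetric. *)
Lemma wedge_admissible D : wedge D D != 0 -> admissible D.
Proof.
apply: contra_neqT; rewrite !negb_or !negbK => /and3P[/eqP D0 /eqP D1 /eqP W].
have W' : wedge D D 1 0 = 0.
  by rewrite wedgeE -[RHS]oppr0 -W wedgeE; ring.
apply/matrixP => i j; rewrite [RHS]mxE; move: i; apply: ord3_case; move: j; apply: ord3_case;
  by rewrite ?W ?W' // wedgeE ?D0 ?D1; ring.
Qed.

Lemma admissible_neq0 D : admissible D -> D != 0.
Proof.
by apply: contraTneq => ->; rewrite /admissible wedgeE !mxE mulr0 subrr eqxx.
Qed.

Lemma relation_open : open relation.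
Proof.
have -> : relation = [set z : J | jder z 0 ord_max != 0] `|`
    [set z : J | jder z 1 ord_max != 0] `|`
    [set z : J | wedge (jder z) (jder z) 0 1 != 0].
  apply/seteqP; split=> z.
    by move=> /or3P[?|?|?]; [left; left|left; right|right].
  by move=> [[?|?]|?]; apply/or3P; [apply: Or31|apply: Or32|apply: Or33].
apply: openU; first by apply: openU; apply: open_neq0_fun; exact: jder_continuous.
apply: open_neq0_fun.
have -> : (fun z : J => wedge (jder z) (jder z) 0 1) =
    (fun z : J => jder z 0 0 * jder z 1 1 - jder z 1 0 * jder z 0 1).
  by apply/funext => z; rewrite wedgeE.
move=> z; apply: (@continuous_at_sub R J (fun z => jder z 0 0 * jder z 1 1)
  (fun z => jder z 1 0 * jder z 0 1)); apply: continuousM; exact: jder_continuous.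
Qed.

(* On the slice F + lam (x) w the relation reads w_z != 0, which is preserved
   along paths together with the sign of w_z. *)
Lemma not_ample_along (C : set J) (F : J) lam w0 : C `<=` relation -> C F -> lam != 0 ->
  jder F = lam^T *m w0 ->
  ~ ample_along C (@jproj _ _ _ X 1 1 : J -> J) (jbase F) (hyp (jbase F) lam).
Proof.
move=> CS CF l0 DF; have -> : (@jproj _ _ _ X 1 1 : J -> J) = id.
  by apply/funext => z; exact: jproj_id.
move=> /(_ F CF erefl d0 (proj2 (is_fchartP d0) erefl) (@germ_dom_trivial _ _ _ _)).
have PF w : @principal R 2 3 X 1 (hyp (jbase F) lam) F
    (mkjet (jbase F) (jval F) (lam^T *m w)).
  apply/principalP => //; exists (w - w0).
  by rewrite mulmxBr DF addrC subrK.
have Fw : F = mkjet (jbase F) (jval F) (lam^T *m w0) by rewrite -DF mkjetK.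
have CPF : (C `&` @principal R 2 3 X 1 (hyp (jbase F) lam) F) F.
  by split=> //; have := PF w0; rewrite -Fw.
rewrite /ample_map => /(_ F CPF)/seteqP[_].
(* Ampleness would put the zero differential in the convex hull. *)
move=> /(_ (jcoord d0 (mkjet (jbase F) (jval F) (lam^T *m 0)))).
case; first by exists (mkjet (jbase F) (jval F) (lam^T *m 0)).
move=> m [t [y [t0 t1 yP]]]; rewrite jcoordE !mkjetE mulmx0.
have [a la] : exists a, lam 0 a != 0 by apply/rV0Pn.
(* On the slice [h] is lam_a w_z with lam_a nonzero, so it has no zero on [C]. *)
pose h (z : J) := jder z a ord_max.
have slice z : C z -> @principal R 2 3 X 1 (hyp (jbase F) lam) F z ->
    [/\ jbase z = jbase F, jval z = jval F & h z != 0].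
  move=> Cz /(principalP _ _ l0)[w zE]; rewrite zE in Cz *.
  rewrite /h !mkjetE; split=> //; move: Cz => /CS.
  rewrite /relation /= /admissible mkjetE DF -mulmxDr wedge_pure_tensor_self !pure_tensorE mxE.
  rewrite [(0 : 'M[R]_3) 0 1]mxE eqxx orbF !mulf_eq0 !negb_or => /orP[]/andP[_ w3]; exact/andP.
have yD i : exists2 D, y i = jvec (jbase F) (jval F) D & 0 < h F * D a ord_max.
  have [z [gam [cgam g0 g1 gP]] <-] := yP i.
  have [C1 P1] : (C `&` @principal R 2 3 X 1 (hyp (jbase F) lam) F) z.
    by rewrite -g1; apply: gP; rewrite ler01 lexx.
  have [b1 v1 h1] := slice z C1 P1.
  exists (jder z); first by rewrite jcoordE b1 v1.
  rewrite -[jder z a _]/(h z) ltNge; apply/negP => hle.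
  have chg : {within `[0, 1], continuous (h \o gam)}.
    by move=> s; apply: (continuous_comp (cgam s)); exact: jder_continuous.
  have [|s] := @IVT _ (h \o gam) 0 1 0 ler01 chg.
    rewrite /= g0 g1.
    exact: mulr_le0_min_max hle.
  rewrite in_itv /= => s01 hs.
  by have [Cs Ps] := gP s s01; have [_ _ /eqP hn] := slice _ Cs Ps; exact: hn hs.
have {}yD i : exists D, y i = jvec (jbase F) (jval F) D /\ 0 < h F * D a ord_max.
  by have [D] := yD i; exists D.
have [D {}yD] := choice yD.
under eq_bigr do rewrite (yD _).1.
rewrite jvec_affine_comb// => /jvec_inj[_ _ /matrixP/(_ a ord_max)].
rewrite mxE summxE => /esym/(congr1 (fun r => h F * r)); rewrite mulr0 mulr_sumr => e.
(* The zero differential is a convex combination of differentials whose entry has the sign of [h F]: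
   all weights vanish, although they sum to 1. *)
have {e} : \sum_i t i * (h F * D i a ord_max) = 0.
  by rewrite -[RHS]e; apply: eq_bigr => i _; rewrite mxE mulrCA.
move/eqP; rewrite psumr_eq0 => [/allP H|i _]; last by rewrite mulr_ge0// ltW// (yD i).2.
move: t1; rewrite big1 => [/eqP|i _]; first by rewrite eq_sym oner_eq0.
apply/eqP; have := H i (mem_index_enum _); rewrite mulf_eq0.
by have /gt_eqF -> := (yD i).2; rewrite orbF.
Qed.

End Relation.

(** * Avoidance template *)

Section Configurations.
Context {R : realType}.
Implicit Types (p lam mu : 'rV[R]_2).

Definition det2 lam mu : R := lam 0 0 * mu 0 1 - lam 0 1 * mu 0 0.

Lemma det2_scale lam c : det2 lam (c *: lam) = 0.
Proof. by rewrite /det2 !mxE; ring. Qed.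

Lemma det2_eq0 lam mu : lam != 0 -> det2 lam mu = 0 -> exists c, mu = c *: lam.
Proof.
move=> l0 /eqP; rewrite subr_eq0 => /eqP d0.
have [l|l] := rV2_neq0 l0.
  exists (mu 0 0 / lam 0 0); apply/rowP; apply: ord2_case; rewrite mxE ?divfK//.
  by apply: (mulfI l); rewrite d0; field.
exists (mu 0 1 / lam 0 1); apply/rowP; apply: ord2_case; rewrite mxE ?divfK//.
by apply: (mulfI l); rewrite -d0; field.
Qed.

Lemma hyp_neq0 p lam mu : lam != 0 -> hyp p mu = hyp p lam -> mu != 0.
Proof.
move=> l0 /hyp_eqP H; apply: contra_neq l0 => m0; apply/rowP => i.
have  := (H (basis_vec R i)).1; rewrite m0 trmx0 mulmx0 => /(_ erefl).
by rewrite -rowE => /rowP/(_ 0); rewrite !mxE.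
Qed.

(** A bijection from the range of [f] to [I_m], composed with [f], is a surjective self-map of a
    finite set. Its section is injective, hence onto, so the self-map is injective and [f] as
    well. *)
Lemma card_range_inj (T : Type) m (f : 'I_m -> T) :
  (range f #= `I_m)%card <-> injective f.
Proof.
split=> [|finj]; last first.
  apply: card_eq_trans (inj_card_eq _) _; first by move=> i j _ _; exact: finj.
  by rewrite card_eq_sym; exact: card_II.
move=> /card_set_bijP[g [gf _ gsurj]].
have gm i : (g (f i) < m)%N by apply: gf; exists i.
pose h i := Ordinal (gm i).
have /choice[s sK] : forall y : 'I_m, exists i, h i = y.
  move=> y; have [|_ [i _ <-] gy] := gsurj y; first exact: ltn_ord.
  by exists i; apply/val_inj.
have sinj : injective s by move=> y z /(congr1 h); rewrite !sK.
move=> i j fij; have /codomP[y iy] := injF_onto sinj i.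
have /codomP[z jz] := injF_onto sinj j.
have : h i = h j by apply/val_inj; rewrite /= fij.
by rewrite iy jz !sK => ->.
Qed.

Lemma hconf_rowsP p m (L : 'M[R]_(m, 2)) :
  hconf (p : euclid R 2) m (rows_conf euclid_chart (p : euclid R 2) L) <->
  (forall i, row i L != 0) /\ (forall i j, i != j -> det2 (row i L) (row j L) != 0).
Proof.
split=> [[hypL /card_range_inj Linj]|[L0 Ldet]]; last first.
  split=> [_ [i _ <-]|]; first by apply/is_hyperplaneP; exists (row i L).
  apply/card_range_inj => i j /(hyp_eq_scale (L0 i) (L0 j))[c _ ec].
  by apply/eqP; apply: contraT => /Ldet; rewrite ec det2_scale eqxx.
have L0 i : row i L != 0.
  have [|lam l0] := (is_hyperplaneP p (hyp p (row i L))).1; last exact: hyp_neq0.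
  by apply: hypL; exists i.
split=> // i j; apply: contraNneq => /(det2_eq0 (L0 i))[c jE].
apply/eqP/Linj; have c0 : c != 0 by apply: contraNneq (L0 j) => c0; rewrite jE c0 scale0r.
by rewrite jE; exact/esym/hyp_scale.
Qed.

End Configurations.

Section Template.
Context {R : realType}.
Local Notation X := (@trivial_bundle R 2 3).
Local Notation J := (jet_space X 1).

(** The condition bears on all covectors whose kernel is in the configuration, hence is independent
    of a choice of equations; by [template_rowsP] one covector per hyperplane suffices. *)
Definition template : set (J * set (set (tvec (euclid R 2)))) :=
  [set z | [/\ relation z.1, exists m, hconf (jbase z.1) m z.2 &
    forall lam, lam != 0 -> z.2 (hyp (jbase z.1) lam) -> restr lam (jder z.1) != 0]].

Lemma restr_scale k lam c (D : 'M[R]_(2, k)) : restr (c *: lam) D = c *: restr lam D.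
Proof. by rewrite -[c *: lam]add0r restr_linear restr0l add0r. Qed.

Lemma template_rowsP (F : J) m (L : 'M[R]_(m, 2)) :
  hconf (jbase F) m (rows_conf euclid_chart (jbase F) L) ->
  template (F, rows_conf euclid_chart (jbase F) L) <->
  relation F /\ forall i, restr (row i L) (jder F) != 0.
Proof.
move=> hL; have [L0 _] := (hconf_rowsP _ _).1 hL.
split=> [[SF _ tF]|[SF rF]].
  by split=> // i; apply: tF => //; exists i.
split=> //=; first by exists m.
move=> lam l0 [i _ e]; have [c c0 ->] := hyp_eq_scale (L0 i) l0 e.
by rewrite restr_scale scaler_eq0 (negbTE c0) /=; exact: rF.
Qed.

Lemma near_neq0 (T : topologicalType) (f : T -> R) x :
  {for x, continuous f} -> f x != 0 -> \forall y \near x, f y != 0.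
Proof.
move=> cf fx; have nfx : nbhs (f x) [set y | y != 0].
  by apply: open_nbhs_nbhs; split=> //; exact: open_neq.
by have := cf _ nfx.
Qed.

Lemma det2_near m (L : 'M[R]_(m, 2)) :
  (forall i j, i != j -> det2 (row i L) (row j L) != 0) ->
  \forall L' \near L, forall i j, i != j -> det2 (row i L') (row j L') != 0.
Proof.
move=> dL; pose P i j := [set L' : 'M[R]_(m, 2) | i != j -> det2 (row i L') (row j L') != 0].
suff : \forall L' \near L, forall i, forall j, P i j L' by [].
apply: (@filter_forall _ 'I_m (fun i L' => forall j, P i j L') (nbhs L) _) => i.
apply: (@filter_forall _ 'I_m (P i) (nbhs L) _) => j.
have [->|ij] := eqVneq i j; first by near=> L'; rewrite /P /= eqxx.
suff : \forall L' \near L, det2 (row i L') (row j L') != 0 by apply: filterS => L' ? _.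
apply: (@near_neq0 _ (fun L' : 'M[R]_(m, 2) => det2 (row i L') (row j L')) L _ (dL i j ij)).
have -> : (fun L' : 'M[R]_(m, 2) => det2 (row i L') (row j L')) =
   (fun L' : 'M[R]_(m, 2) => L' i 0 * L' j 1 - L' i 1 * L' j 0).
  by apply/funext => L'; rewrite /det2 !mxE.
apply: (@continuous_at_sub R _ (fun L' : 'M[R]_(m, 2) => L' i 0 * L' j 1)
   (fun L' : 'M[R]_(m, 2) => L' i 1 * L' j 0));
  by apply: continuousM; exact: coord_continuous.
Unshelve. all: by end_near. Qed.

(** Finitely many scalars have to stay nonzero. As [restr lam D != 0] forces [lam != 0], nearby rows
    are nonzero, and only the pairwise determinants remain to be controlled to stay in H-Conf. *)
Lemma template_open : open_in_hconf relation (id : J -> J) template.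
Proof.
split=> [F Xi [SF hF _]|m c F L]; first by split.
move=> -> _ hL /(template_rowsP hL)[SF rF].
have [_ Ldet] := (hconf_rowsP _ _).1 hL.
have nr : \forall z \near ((F, L) : J * 'M[R]_(m, 2)), forall i, restr (row i z.2) (jder z.1) != 0.
  apply: (@filter_forall _ 'I_m
    (fun i (z : J * 'M[R]_(m, 2)) => restr (row i z.2) (jder z.1) != 0) (nbhs (F, L)) _) => i.
  have [l rl] : exists l, restr (row i L) (jder F) 0 l != 0 by apply/rV0Pn.
  suff : \forall z \near ((F, L) : J * 'M[R]_(m, 2)), restr (row i z.2) (jder z.1) 0 l != 0.
    by apply: filterS => z zl; apply/rV0Pn; exists l.
  apply: (@near_neq0 _ (fun z : J * 'M[R]_(m, 2) => restr (row i z.2) (jder z.1) 0 l) (F, L) _ rl).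
  have -> : (fun z : J * 'M[R]_(m, 2) => restr (row i z.2) (jder z.1) 0 l) =
    (fun z => z.2 i 0 * jder z.1 1 l - z.2 i 1 * jder z.1 0 l).
    by apply/funext => z; rewrite restrE !mxE.
  have cL a : {for (F, L), continuous (fun z : J * 'M[R]_(m, 2) => z.2 i a)}.
    apply: (@continuous_comp _ _ _ (fun z : J * 'M[R]_(m, 2) => z.2) (fun L' => L' i a)).
      exact: cvg_snd.
    exact: coord_continuous.
  have cF a : {for (F, L), continuous (fun z : J * 'M[R]_(m, 2) => jder z.1 a l)}.
    apply: (@continuous_comp _ _ _ (fun z : J * 'M[R]_(m, 2) => z.1) (fun z => jder z a l)).
      exact: cvg_fst.
    exact: jder_continuous.
  by apply: (@continuous_at_sub R _ (fun z : J * 'M[R]_(m, 2) => z.2 i 0 * jder z.1 1 l)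
    (fun z : J * 'M[R]_(m, 2) => z.2 i 1 * jder z.1 0 l)); apply: continuousM.
have nd : \forall z \near ((F, L) : J * 'M[R]_(m, 2)),
    forall i j, i != j -> det2 (row i z.2) (row j z.2) != 0.
  have csnd : snd @ nbhs ((F, L) : J * 'M[R]_(m, 2)) --> L by exact: cvg_snd.
  exact: csnd _ (det2_near Ldet).
apply: filterS2 nr nd => -[F' L'] /= rL' dL' SF'.
apply/template_rowsP => //; apply/hconf_rowsP; split=> // i.
by apply: contra_neq (rL' i) => ->; exact: restr0l.
Qed.

Lemma restr_exists k (D : 'M[R]_(2, k)) : D != 0 -> exists lam, restr lam D != 0.
Proof.
move=> D0; apply: contrapT => H; move/eqP: D0; apply.
have r0 lam : restr lam D = 0.
  by apply/eqP; apply: contraT => rl; exfalso; apply: H; exists lam.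
apply/row_matrixP; apply: ord2_case; apply/rowP => j; rewrite !mxE.
  have := congr1 (fun v : 'rV[R]_k => v 0 j) (r0 (basis_vec R 1)).
  by rewrite restrE !mxE /= mul0r mul1r sub0r => /eqP; rewrite oppr_eq0 => /eqP.
have := congr1 (fun v : 'rV[R]_k => v 0 j) (r0 (basis_vec R 0)).
by rewrite restrE !mxE /= mul0r mul1r subr0.
Qed.

Lemma near_affine_neq0 (a b : R) : b != 0 -> \forall e \near 0^', a + e * b != 0.
Proof.
move=> b0; have [->|a0] := eqVneq a 0.
  near=> e; rewrite add0r mulf_neq0//; near: e; exact: nbhs_dnbhs_neq.
apply: cvg_within; apply: (@near_neq0 _ (fun e : R => a + e * b) 0).
  by apply: continuousD; [exact: cst_continuous|exact: scalel_continuous].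
by rewrite mul0r addr0.
Unshelve. all: by end_near. Qed.

(** All rows are moved in one direction [mu] with [restr mu (jder F) != 0], which exists because an
    admissible differential is nonzero. For each row some coordinate of [restr] is then affine in
    [e] with nonzero slope, hence nonzero for small [e != 0]; the determinants survive by
    openness. *)
Lemma template_dense (F : J) m : relation F ->
  @dense_in_hconf R 2 3 X (jbase F) m [set Xi | template (F, Xi)].
Proof.
move=> SF c L -> _ /= hL.
have [mu rmu] := restr_exists (admissible_neq0 SF).
have [l rl] : exists l, restr mu (jder F) 0 l != 0 by apply/rV0Pn.
have [_ Ldet] := (hconf_rowsP _ _).1 hL.
pose Le (e : R) : 'M[R]_(m, 2) := L + e *: (\matrix_(i, j) mu 0 j).
have cLe : Le e @[e --> 0^'] --> L.
  have c0 : {for 0, continuous Le}.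
    apply: (@continuousD _ _ _ (fun=> L) (fun e : R => e *: (\matrix_(i, j) mu 0 j)) 0).
      exact: cst_continuous.
    exact: scalel_continuous.
  rewrite /prop_for /continuous_at {2}/Le scale0r addr0 in c0.
  exact: cvg_within_filter c0.
move=> B nB.
have nrestr : \forall e \near (0 : R)^', forall i, restr (row i (Le e)) (jder F) != 0.
  apply: (@filter_forall _ 'I_m (fun i e => restr (row i (Le e)) (jder F) != 0) (0 : R)^' _) => i.
  near=> e; apply/rV0Pn; exists l.
  have -> : row i (Le e) = row i L + e *: mu by apply/rowP => j; rewrite !mxE.
  rewrite restr_linear addmxE scalemxE.
  by near: e; exact: near_affine_neq0.
have nBe : \forall e \near (0 : R)^', B (Le e) := cLe _ nB.
have nde : \forall e \near (0 : R)^',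
    forall i j, i != j -> det2 (row i (Le e)) (row j (Le e)) != 0 := cLe _ (det2_near Ldet).
have PF : ProperFilter (0 : R)^' by exact: Proper_dnbhs_numFieldType.
have [e [[Be dete] re]] := @filter_ex _ _ PF _ (filterI (filterI nBe nde) nrestr).
have hLe : hconf (jbase F) m (rows_conf euclid_chart (jbase F) (Le e)).
  apply/hconf_rowsP; split=> // i.
  by apply: contra_neq (re i) => ->; exact: restr0l.
exists (Le e); split=> //; split=> //; exact/template_rowsP.
Unshelve. all: by end_near. Qed.

Lemma relation_ample_up_to_avoidance  : @ample_up_to_avoidance R 2 3 X 1 relation.
Proof.
move=> r' r1; have -> : r' = 1%N by apply/eqP; rewrite eqn_leq andbC.
exists template; rewrite (_ : (@jproj _ _ _ X 1 1 : J -> J) = id); last first.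
  by apply/funext => z; exact: jproj_id.
split=> [|F Xi Xi' sXi [SF [m hXi] tF]|p m Xi hXi tau Xitau|F m SF]; last exact: template_dense.
- exact: template_open.
- split=> //=; last by move=> lam l0 /sXi; exact: tF.
  have [hypXi cardXi] := hXi.
  have [m' cardXi'] : finite_set Xi' by apply: sub_finite_set sXi _; exists m.
  by exists m'; split=> // tau /sXi; exact: hypXi.
have [lam l0 tauE] := (is_hyperplaneP p tau).1 (hXi.1 _ Xitau).
rewrite tauE in Xitau *.
have := @ample_along_immersive _ [set F | template (F, Xi)] p lam l0.
rewrite (_ : (@jproj _ _ _ X 1 1 : J -> J) = id); last first.
  by apply/funext => z; exact: jproj_id.
apply=> [z zp Wz|z [_ _ tz] zp]; last by apply: tz => //; rewrite /= zp.
split=> /=; [exact: wedge_admissible|by rewrite zp; exists m|move=> mu m0 _].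
(* A differential that kills a direction has rank at most one, so an immersive jet meets the
   conditions of all hyperplanes of [Xi]. *)
by apply: contra_neq Wz => /(restr_eq0 m0)[w ->]; exact: wedge_pure_tensor_self.
Qed.

(** * Invariance under diffeomorphisms *)

Lemma admissible_mulmxl (B : 'M[R]_2) (D : 'M[R]_(2, 3)) :
  admissible (B *m D) -> admissible D.
Proof.
have BD i j : (B *m D) i j = B i 0 * D 0 j + B i 1 * D 1 j by rewrite mxE sum_ord2.
(* Left multiplication by [B] mixes the two z-partials linearly and multiplies the minor of dx and
   dy by det B. *)
have -> : admissible (B *m D) = [|| B 0 0 * D 0 ord_max + B 0 1 * D 1 ord_max != 0,
    B 1 0 * D 0 ord_max + B 1 1 * D 1 ord_max != 0 |
    (B 0 0 * B 1 1 - B 0 1 * B 1 0) * wedge D D 0 1 != 0].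
  by rewrite /admissible !wedgeE !BD; congr [|| _, _ | _ != 0]; ring.
apply: contraTT; rewrite !negb_or !negbK => /and3P[/eqP -> /eqP -> /eqP ->].
by rewrite !mulr0 addr0 eqxx.
Qed.

Lemma relation_diff_invariant : @diff_invariant R 2 3 X (@trivial_lift R 2 3) 1 relation.
Proof.
move=> phi g h [gphi hp hE].
have [_ _ Dg] := jet_of1E g; have [_ _ Dh] := jet_of1E h.
rewrite /relation /= Dg Dh => {Dg Dh}.
pose q0 : 'rV[R]_2 := g_pt h; pose f : 'rV[R]_2 -> 'rV[R]_2 := phi.
pose psi : 'rV[R]_2 -> 'rV[R]_2 := ld_inv phi.
have gE := @global_chart_euclid R 2.
have psiq0 : psi q0 = g_pt g by rewrite /psi /q0 hp ld_funK.
have spsi : smooth_near psi q0.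
  have := ld_inv_smooth gphi; rewrite -hp.
  by move/(smooth_at_global_chart _ _ gE gE).
have sphi : smooth_near f (psi q0).
  by rewrite psiq0; have := ld_smooth gphi; move/(smooth_at_global_chart _ _ gE gE).
have fpsi : \forall q \near q0, f (psi q) = q.
  have im : nbhs (g_pt h : euclid R 2) (phi @` ld_dom phi).
    by apply: open_nbhs_nbhs; split; [exact: ld_im_open|rewrite hp; exists (g_pt g)].
  have {}im : \forall q \near q0, (phi @` ld_dom phi) q := continuous_global_chartV gE im.
  apply: filterS im => _ [p' dp' <-].
  by rewrite /f /psi /= ld_funK.
have hpsi : \forall q \near q0, germ_map g (psi q) = germ_map h q.
  have nh : \forall q \near q0, g_sec h q = trivial_lift phi (g_sec g (psi q)) :=
    continuous_global_chartV gE hE.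
  apply: filterS nh => q e.
  by rewrite /germ_map e.
have jac_near (k : nat) (u v : 'rV[R]_2 -> 'rV[R]_k) :
    (\forall q \near q0, u q = v q) -> jacmx u q0 = jacmx v q0.
  by move=> uv; apply/matrixP => i j; rewrite !mxE (near_eq_derive _ uv).
have Jh : gjac h = jacmx psi q0 *m gjac g.
  rewrite /gjac -psiq0 -jacmx_comp//; first exact/esym/jac_near.
  by rewrite psiq0; exact: nbhs_singleton (germ_map_smooth g).
have J1 : jacmx psi q0 *m jacmx f (psi q0) = 1%:M.
  rewrite -jacmx_comp// (jac_near _ _ id)//.
  by apply/matrixP => i j; rewrite !mxE derive_id mxE eqxx eq_sym.
(* A one-sided inverse of a square matrix is two-sided, so multiplying [gjac h] by the Jacobian of
   [phi] gives back [gjac g]. *)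
move/mulmx1C: J1 => J1 ag; apply: (@admissible_mulmxl (jacmx f (psi q0))).
by rewrite Jh mulmxA J1 mul1mx.
Qed.

End Template.

(** * Principal frames *)

Section Frames.
Context {R : realType}.
Local Notation X := (@trivial_bundle R 2 3).
Local Notation d0 := (@trivial_fchart R 2 3).
Local Notation J := (jet_space X 1).
Implicit Types (p lam mu : 'rV[R]_2).

(** If all fields agreed with the kernel of [lam] at [p], the principal directions would only give
    the differentials lam (x) w and could not fill the fibre. This provides both a field in any
    frame and the minimality of frames with two fields. *)
Lemma spans_fibres_neq (U : set (base X)) (Phi : set (base X -> set (tvec (base X)))) p lam :
  @spans_fibres R 2 3 X 1 U Phi -> U p -> lam != 0 ->
  exists2 tau, Phi tau & tau p <> hyp p lam.
Proof.
move=> sPhi Up l0; apply: contrapT => H.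
have tauE tau : Phi tau -> tau p = hyp p lam.
  by move=> Ptau; apply: contrapT => ne; apply: H; exists tau.
pose z : J := mkjet p 0 0.
(* [mu] is [lam] turned by a right angle, so that [restr lam] takes mu (x) w to |lam|^2 w. *)
pose mu : 'rV[R]_2 := \row_i (if i == 0 then - lam 0 1 else lam 0 0).
pose z' : J := mkjet p 0 (mu^T *m const_mx 1).
have /seteqP[_] := sPhi z (eq_ind_r U Up (jbase_mkjet _ _ _)) d0 (proj2 (is_fchartP d0) erefl)
  (@germ_dom_trivial _ _ _ _).
move=> /(_ (jcoord d0 z')); case.
  by exists z' => //; apply/jproj0P; rewrite !mkjetE.
move=> m [t [y [t1 yP]]].
have {}yP i : exists w, y i = jvec p 0 (lam^T *m w).
  have [z1 Pz1 <-] := yP i; case: Pz1 => [->|[tau Ptau]].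
    by exists 0; rewrite jcoordE !mkjetE mulmx0.
  have zb : jbase z = p := jbase_mkjet _ _ _.
  rewrite zb (tauE _ Ptau) -{1}zb.
  move=> /(principalP _ _ l0)[w ->]; exists w.
  by rewrite jcoordE !mkjetE add0r.
have [w {}yP] := choice yP.
under eq_bigr do rewrite yP.
rewrite jvec_affine_comb// jcoordE !mkjetE => /jvec_inj[_ _ e].
have : restr lam (jder z') = 0.
  rewrite jder_mkjet e; under eq_bigr do rewrite scalemxAr.
  rewrite -mulmx_sumr -[_ *m _]add0r restr_principal.
  by apply/rowP => j; rewrite restrE !mxE !mulr0 subrr.
rewrite jder_mkjet => /rowP/(_ 0); rewrite restrE !pure_tensorE !mxE /= => /eqP.
have -> : lam 0 0 * (lam 0 0 * 1) - lam 0 1 * (- lam 0 1 * 1) = lam 0 0 ^+ 2 + lam 0 1 ^+ 2.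
  by ring.
by rewrite gt_eqF// sqnorm_rV2_gt0.
Qed.

Lemma constant_integrable lam (O : set (base X)) : lam != 0 ->
  integrable_field O (fun p : base X => hyp p lam).
Proof.
move=> l0 q _; pose g (p : base X) : R := ((p : 'rV[R]_2) *m lam^T) 0 0; exists g.
pose L (v : 'rV[R]_2) : R^o := (v *m lam^T) 0 0.
have Llin : linear L by move=> a u v; rewrite /L mulmxDl -scalemxAl !mxE.
pose LL := GRing.isLinear.Build _ _ _ _ L Llin.
pose L' : {linear 'rV[R]_2 -> R^o} := HB.pack L LL.
have gL : (g \o id : 'rV[R]_2 -> R^o) = (fun x => L' x + 0).
  by apply/funext => x; rewrite addr0.
have gE := @global_chart_euclid R 2.
have cL : continuous L'.
  move=> v; have := @continuous_comp _ _ _ (fun v : 'rV[R]_2 => v *m lam^T)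
    (fun A : 'M[R]_1 => A 0 0) v (@continuous_mulmxr R 1 2 1 lam^T v) (@coord_continuous _ _ _ 0 0 _).
  by [].
near=> q'; split.
- move=> c /(global_atlasP gE) -> _; rewrite (chart_inv_global gE) gL.
  exact: smooth_near_affine.
- by apply/is_hyperplaneP; exists lam.
apply/seteqP; split=> v [vq' vl]; split=> //.
  move=> c /(global_atlasP gE) -> _; rewrite (chart_inv_global gE) gL.
  have [_ ->] := is_derive_affine L' 0 (Defs.coord (Chart setT id) q') (tv_comp v (Chart setT id)).
  by rewrite /= /L vl mxE.
have := vl euclid_chart (proj2 (global_atlasP gE _) erefl) I.
rewrite (chart_inv_global gE) gL.
have [_ ->] := is_derive_affine L' 0 (Defs.coord euclid_chart q') (tv_comp v euclid_chart).
by move=> Lv; apply/rowP => i; rewrite ord1 [RHS]mxE; exact: Lv.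
Unshelve. all: by end_near. Qed.

Definition frame lam mu : set (base X -> set (tvec (base X))) :=
  [set tau | tau = (fun p : base X => hyp p lam) \/ tau = (fun p : base X => hyp p mu)].

(** Cramer's rule in the basis of covectors [lam], [mu]. *)
Lemma det2_decompose k lam mu (E : 'M[R]_(2, k)) : det2 lam mu != 0 ->
  exists u w, E = lam^T *m u + mu^T *m w.
Proof.
move=> d0.
exists ((det2 lam mu)^-1 *: (mu 0 1 *: row 0 E - mu 0 0 *: row 1 E)),
  ((det2 lam mu)^-1 *: (lam 0 0 *: row 1 E - lam 0 1 *: row 0 E)).
apply/matrixP => i j; rewrite addmxE !pure_tensorE !mxE; move: i.
by apply: ord2_case; rewrite /det2 in d0 *; field.
Qed.

Lemma frame_spans U lam mu : det2 lam mu != 0 -> lam != 0 -> mu != 0 ->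
  @spans_fibres R 2 3 X 1 U (frame lam mu).
Proof.
move=> dn0 l0 m0 z Uz d /is_fchartP -> _.
have prJ (nu : 'rV[R]_2) z1 : nu != 0 -> @principal R 2 3 X 1 (hyp (jbase z) nu) z z1 ->
    jcoord d0 z1 = jvec (jbase z) (jval z) (jder z1).
  by move=> n0 /(principalP _ _ n0)[w ->]; rewrite jcoordE !mkjetE.
apply/seteqP; split=> [x [m [t [y [t1 yP ->]]]]|_ [z' /jproj0P[pe ye] <-]].
  have {}yP i : exists D, y i = jvec (jbase z) (jval z) D.
    have [z1 Pz1 <-] := yP i; case: Pz1 => [->|[tau [->|->]]].
    - by exists (jder z); rewrite jcoordE.
    - by move=> /(prJ _ _ l0) ->; exists (jder z1).
    - by move=> /(prJ _ _ m0) ->; exists (jder z1).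
  have [D {}yP] := choice yP.
  exists (mkjet (jbase z) (jval z) (\sum_i t i *: D i)).
    by apply/jproj0P; rewrite !mkjetE.
  rewrite jcoordE !mkjetE -jvec_affine_comb//.
  by apply: eq_bigr => i _; rewrite yP.
have [u [w E]] := det2_decompose (jder z' - jder z) dn0.
pose zz (i : 'I_3) : J := if i == 0 then mkjet (jbase z) (jval z) (jder z + lam^T *m u)
  else if i == 1 then mkjet (jbase z) (jval z) (jder z + mu^T *m w) else z.
(* The jet z + lam (x) u + mu (x) w is the combination of z + lam (x) u, z + mu (x) w and z with
   weights 1, 1 and -1. *)
pose t (i : 'I_3) : R := if i == ord_max then -1 else 1.
have sum3 (V : nmodType) (f : 'I_3 -> V) : \sum_i f i = f 0 + f 1 + f ord_max.
  rewrite !big_ord_recl big_ord0 addr0 addrA.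
  by congr (f _ + f _ + f _); apply/val_inj.
exists 3%N, t, (fun i => jcoord d0 (zz i)); split.
- by rewrite sum3 /t /=; ring.
- move=> i; exists (zz i) => //; rewrite /zz; case: ifP => _; [right|case: ifP => _; [right|by left]].
    exists (fun p : base X => hyp p lam); first by left.
    by apply/principalP => //; exists u.
  exists (fun p : base X => hyp p mu); first by right.
  by apply/principalP => //; exists w.
have zzE i : jcoord d0 (zz i) = jvec (jbase z) (jval z) (jder (zz i)).
  by rewrite jcoordE /zz; case: ifP => _; [|case: ifP => _]; rewrite ?mkjetE.
under eq_bigr do rewrite zzE.
rewrite jvec_affine_comb; last by rewrite sum3 /t /=; ring.
rewrite sum3 /t /zz /= !mkjetE jcoordE pe ye; congr jvec.
rewrite -[LHS](subrK (jder z)) E; set A := lam^T *m u; set B := mu^T *m w.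
by apply/matrixP => i j; rewrite !mxE; ring.
Qed.

(** For minimality, a spanning subfamily contains a field different from the kernel of [lam] at [p]
    and one different from the kernel of [mu], hence both fields. *)
Lemma principal_frame_constant U lam mu (p : base X) : open U -> U p ->
  det2 lam mu != 0 -> lam != 0 -> mu != 0 ->
  @principal_frame R 2 3 X 1 U (frame lam mu).
Proof.
move=> oU Up dn0 l0 m0; split=> //.
- exists setT; first by split=> //; exact: openT.
  by move=> tau [->|->]; exact: constant_integrable.
- exact: frame_spans.
move=> Psi sPsi spPsi; apply/seteqP; split=> // tau.
have [a Pa na] := spans_fibres_neq spPsi Up l0.
have [b Pb nb] := spans_fibres_neq spPsi Up m0.
have aE : a = (fun p : base X => hyp p mu) by case: (sPsi _ Pa) => // aE; rewrite aE in na.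
have bE : b = (fun p : base X => hyp p lam) by case: (sPsi _ Pb) => // bE; rewrite bE in nb.
by case=> ->; [rewrite -bE|rewrite -aE].
Qed.

(** A frame contains at least one field because it spans; its hyperplane, the kernel of some [lam],
    is spoilt by the differential of the map (0, 0, lam), which is admissible. *)
Lemma relation_not_ample_coord : ~ @ample_coord R 2 3 X 1 relation.
Proof.
move=> /(_ 1%N isT (0 : 'rV[R]_2))[U [Phi [[oU [V [oV cUV] intV] sPhi _] U0 H]]].
have l0 : (basis_vec R 0 : 'rV[R]_2) != 0.
  by apply/rV0Pn; exists 0; rewrite mxE !eqxx oner_eq0.
have [tau Ptau _] := spans_fibres_neq sPhi U0 l0.
have [g /nbhs_singleton[_ /is_hyperplaneP[lam ln0 tauE] _]] :=
  intV tau Ptau 0 (cUV _ (subset_closure U0)).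
pose F : J := mkjet 0 0 (lam^T *m basis_vec R ord_max).
have SF : relation F.
  have [l|l] := rV2_neq0 ln0; apply/or3P; [apply: Or31|apply: Or32];
  by rewrite mkjetE pure_tensorE mxE !eqxx mulr1.
have := @not_ample_along _ relation F lam (basis_vec R ord_max) (fun z Sz => Sz) SF ln0 (jder_mkjet _ _ _).
rewrite jbase_mkjet -tauE; apply; exact: H.
Qed.

(** Constant frames exist around every point, so ampleness would give ampleness in coordinate
    directions. *)
Lemma relation_not_ample : ~ @ample R 2 3 X 1 relation.
Proof.
move=> aS; apply: relation_not_ample_coord => r' r1 p.
have r1E : r' = 1%N by apply/eqP; rewrite eqn_leq andbC.
rewrite r1E; pose lam : 'rV[R]_2 := basis_vec R 0; pose mu : 'rV[R]_2 := basis_vec R 1.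
have l0 : lam != 0 by apply/rV0Pn; exists 0; rewrite mxE !eqxx oner_eq0.
have m0 : mu != 0 by apply/rV0Pn; exists 1; rewrite mxE !eqxx oner_eq0.
have dn0 : det2 lam mu != 0 by rewrite /det2 !mxE /= mulr0 subr0 mulr1 oner_eq0.
exists setT, (frame lam mu); split=> //.
  by apply: (@principal_frame_constant _ _ _ p) => //; exact: openT.
by move=> q tau _ [->|->]; apply: aS => //; apply/is_hyperplaneP; [exists lam|exists mu].
Qed.

End Frames.

(** * The relation attached to a formal solution *)

Section SquaredNorm.
Context {R : realType}.

(** The squared Euclidean norm is polynomial in the entries, satisfies the parallelogram law and is
    multiplicative on tensors, unlike the sup norm of the normed structure on matrices. *)
Definition sqnorm m n (A : 'M[R]_(m, n)) : R := \sum_i \sum_j A i j ^+ 2.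

Lemma sqnorm_ge0 m n (A : 'M[R]_(m, n)) : 0 <= sqnorm A.
Proof. by apply: sumr_ge0 => i _; apply: sumr_ge0 => j _; exact: sqr_ge0. Qed.

Lemma sqnorm_eq0 m n (A : 'M[R]_(m, n)) : (sqnorm A == 0) = (A == 0).
Proof.
apply/idP/eqP => [|->]; last first.
  by rewrite /sqnorm big1// => i _; rewrite big1// => j _; rewrite mxE expr0n.
rewrite psumr_eq0 => [/allP A0|i _]; last by apply: sumr_ge0 => j _; exact: sqr_ge0.
apply/matrixP => i j; have := A0 i (mem_index_enum _).
rewrite psumr_eq0 => [/allP/(_ j (mem_index_enum _))|l _]; last exact: sqr_ge0.
by rewrite sqrf_eq0 mxE => /eqP.
Qed.

Lemma sqnorm_gt0 m n (A : 'M[R]_(m, n)) : A != 0 -> 0 < sqnorm A.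
Proof. by move=> A0; rewrite lt_def sqnorm_ge0 sqnorm_eq0 A0. Qed.

Lemma sqnorm0 m n : sqnorm (0 : 'M[R]_(m, n)) = 0.
Proof. by apply/eqP; rewrite sqnorm_eq0. Qed.

Lemma sqnormN m n (A : 'M[R]_(m, n)) : sqnorm (- A) = sqnorm A.
Proof. by apply: eq_bigr => i _; apply: eq_bigr => j _; rewrite mxE sqrrN. Qed.

Lemma sqnorm_rV n (v : 'rV[R]_n) : sqnorm v = \sum_j v 0 j ^+ 2.
Proof. by rewrite /sqnorm big_ord1. Qed.

Lemma sqnorm_basis n (i : 'I_n) : sqnorm (basis_vec R i) = 1.
Proof.
rewrite sqnorm_rV (bigD1 i)//= big1 => [|j ji]; first by rewrite mxE !eqxx expr1n addr0.
by rewrite mxE (negbTE ji) andbF expr0n.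
Qed.

Lemma sqnorm_tensor m n (a : 'rV[R]_m) (b : 'rV[R]_n) :
  sqnorm (a^T *m b) = sqnorm a * sqnorm b.
Proof.
rewrite !sqnorm_rV mulr_suml; apply: eq_bigr => i _; rewrite mulr_sumr.
by apply: eq_bigr => j _; rewrite mxE big_ord1 mxE exprMn.
Qed.

Lemma sqnorm_rows n (D : 'M[R]_(2, n)) : sqnorm D = sqnorm (row 0 D) + sqnorm (row 1 D).
Proof.
rewrite /sqnorm sum_ord2 !big_ord1.
by congr (_ + _); apply: eq_bigr => j _; rewrite mxE.
Qed.

Lemma parallelogram n (u v : 'rV[R]_n) :
  sqnorm (u + v) + sqnorm (u - v) = 2 * (sqnorm u + sqnorm v).
Proof.
rewrite !sqnorm_rV -!big_split mulr_sumr /=.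
by apply: eq_bigr => j _; rewrite !mxE; ring.
Qed.

Lemma continuous_sqnorm (T : topologicalType) m n (f : T -> 'M[R]_(m, n)) x :
  (forall i j, {for x, continuous (fun z => f z i j)}) ->
  {for x, continuous (fun z => sqnorm (f z))}.
Proof.
move=> cf; apply: continuous_at_sum => i _; apply: continuous_at_sum => j _.
have -> : (fun z => f z i j ^+ 2) = (fun z => f z i j * f z i j).
  by apply/funext => z; rewrite expr2.
by apply: continuousM; exact: cf.
Qed.

(* 1/4 leaves room below the value 1/2 attained by conformal D. *)
Definition stretched lam (D : 'M[R]_(2, 3)) :=
  4^-1 * sqnorm D * sqnorm lam < sqnorm (restr lam D).

(** The two coordinate covectors may not do, since a row of [D] can vanish. The larger row carries
    at least half of |D|^2, which gives one coordinate covector. By the parallelogram law the sum or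
    the difference of the rows has squared norm at least |D|^2, which gives a diagonal covector, of
    squared norm 2. Both ratios are at least 1/2. *)
Lemma stretched_pair (D : 'M[R]_(2, 3)) : D != 0 ->
  exists lam mu : 'rV[R]_2, [/\ lam != 0, mu != 0, det2 lam mu != 0,
    stretched lam D & stretched mu D].
Proof.
move=> /sqnorm_gt0 D0.
pose e0 : 'rV[R]_2 := basis_vec R 0; pose e1 : 'rV[R]_2 := basis_vec R 1.
have n0 : sqnorm e0 = 1 by exact: sqnorm_basis.
have n1 : sqnorm e1 = 1 by exact: sqnorm_basis.
have r0 : restr e0 D = row 1 D by apply/rowP => j; rewrite restrE !mxE /=; ring.
have r1 : restr e1 D = - row 0 D by apply/rowP => j; rewrite restrE !mxE /=; ring.
have neq0 (v : 'rV[R]_2) : sqnorm v != 0 -> v != 0 by rewrite sqnorm_eq0.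
have [s sE] : exists s : bool, sqnorm D <= sqnorm (row 1 D + (-1) ^+ s *: row 0 D).
  have := parallelogram (row 1 D) (row 0 D); rewrite sqnorm_rows.
  set a := sqnorm (_ + _); set b := sqnorm (_ - _) => ab.
  have [h|h] := lerP (sqnorm (row 0 D) + sqnorm (row 1 D)) a.
    by exists false; rewrite expr0 scale1r.
  by exists true; rewrite expr1 scaleN1r -/b; lra.
pose mu : 'rV[R]_2 := e0 - (-1) ^+ s *: e1.
have nmu : sqnorm mu = 2.
  rewrite sqnorm_rV sum_ord2 !mxE /=.
  by case: (s); rewrite ?expr0 ?expr1; ring.
have smu : stretched mu D.
  rewrite /stretched nmu (_ : restr mu D = row 1 D + (-1) ^+ s *: row 0 D).
    by apply: lt_le_trans sE; lra.
  by apply/rowP => j; rewrite restrE !mxE /=; ring.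
have [h|h] := lerP (sqnorm (row 0 D)) (sqnorm (row 1 D)).
  exists e0, mu; split=> //.
  - by apply: neq0; rewrite n0 oner_eq0.
  - by apply: neq0; rewrite nmu pnatr_eq0.
  - rewrite /det2 !mxE /=.
    by case: (s); rewrite ?expr0 ?expr1; apply/eqP; lra.
  by rewrite /stretched n0 r0; move: D0; rewrite sqnorm_rows; lra.
exists e1, mu; split=> //.
- by apply: neq0; rewrite n1 oner_eq0.
- by apply: neq0; rewrite nmu pnatr_eq0.
- rewrite /det2 !mxE /=.
  by case: (s); rewrite ?expr0 ?expr1; apply/eqP; lra.
by rewrite /stretched n1 r1 sqnormN; move: D0; rewrite sqnorm_rows; lra.
Qed.

End SquaredNorm.

Section Subrelation.
Context {R : realType}.
Local Notation X := (@trivial_bundle R 2 3).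
Local Notation J := (jet_space X 1).
Implicit Types (F : base X -> J).

(* A rank one differential lam (x) w is kept iff its kernel v = (- lam_1, lam_0)
   satisfies |dF v|^2 < |dF|^2 |v|^2 / 4, which is polynomial in the 1-jet:
   |dF v|^2 |w|^2 and |v|^2 |w|^2 are the squared norms of wedge dF (lam (x) w)
   and of lam (x) w. *)
Definition subrelation F : set J :=
  [set z | relation z /\ (wedge (jder z) (jder z) != 0 \/
     sqnorm (wedge (jder (F (jbase z))) (jder z)) <
       4^-1 * sqnorm (jder (F (jbase z))) * sqnorm (jder z))].

Lemma subrelation_sub F : subrelation F `<=` relation.
Proof. by move=> z []. Qed.

Lemma jder_neq0 (z : J) : relation z -> jder z != 0.
Proof. exact: admissible_neq0. Qed.

(** Where [F] has rank one it kills its own kernel: the left side of the strict inequality is 0, and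
    the right side is positive because an admissible differential is nonzero. *)
Lemma subrelation_solution F : formal_solution relation F -> formal_solution (subrelation F) F.
Proof.
move=> solF p; have [bF SF smF] := solF p; split=> //; split=> //.
rewrite bF; have [->|] := eqVneq (wedge (jder (F p)) (jder (F p))) 0; last by left.
right; rewrite sqnorm0; have := sqnorm_gt0 (jder_neq0 SF) => n0.
by rewrite !mulr_gt0// invr_gt0.
Qed.

Lemma solution_jder_continuous F i j : formal_solution relation F ->
  continuous (fun p => jder (F p) i j).
Proof.
move=> solF p; have [_ _ [cF _]] := solF p.
by apply: (@continuous_comp _ _ _ F (fun z : J => jder z i j)) => //; exact: jder_continuous.
Qed.

Lemma subrelation_open F : formal_solution relation F -> open (subrelation F).
Proof.
move=> solF.
pose f (z : J) := 4^-1 * sqnorm (jder (F (jbase z))) * sqnorm (jder z) -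
  sqnorm (wedge (jder (F (jbase z))) (jder z)).
have -> : subrelation F = relation `&` ([set z : J | sqnorm (wedge (jder z) (jder z)) != 0] `|`
    f @^-1` [set r | 0 < r]).
  apply/seteqP; split=> z; rewrite /subrelation /= sqnorm_eq0 /f subr_gt0 => -[Sz ?];
    by split.
have cz i j : continuous (fun z : J => jder z i j) by exact: jder_continuous.
have cF i j : continuous (fun z : J => jder (F (jbase z)) i j).
  move=> z; apply: (@continuous_comp _ _ _ (@jbase R 2 3 X 1 : J -> _) (fun p => jder (F p) i j)).
    exact: jbase_continuous.
  exact: solution_jder_continuous.
have cw (g h : J -> 'M[R]_(2, 3)) (z : J) : (forall i j, continuous (fun z => g z i j)) ->
    (forall i j, continuous (fun z => h z i j)) ->
    {for z, continuous (fun z => sqnorm (wedge (g z) (h z)))}.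
  move=> cg ch; apply: continuous_sqnorm => i j.
  have -> : (fun z => wedge (g z) (h z) i j) =
     (fun z => g z 0 i * h z 1 j - g z 1 i * h z 0 j).
    by apply/funext => y; rewrite wedgeE.
  apply: (@continuous_at_sub R J (fun z => g z 0 i * h z 1 j) (fun z => g z 1 i * h z 0 j));
    by apply: continuousM; [exact: cg|exact: ch].
apply: openI; first exact: relation_open.
apply: openU; first by apply: open_neq0_fun => z; exact: (cw _ _ z cz cz).
suff /continuousP : continuous f by apply; exact: open_gt.
move=> z; apply: (@continuous_at_sub R J
  (fun z => 4^-1 * sqnorm (jder (F (jbase z))) * sqnorm (jder z))
  (fun z => sqnorm (wedge (jder (F (jbase z))) (jder z)))); last exact: (cw _ _ z cF cz).
apply: continuousM; last by apply: continuous_sqnorm => i j; exact: cz.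
apply: continuousM; first exact: cst_continuous.
by apply: continuous_sqnorm => i j; exact: cF.
Qed.

Lemma subrelation_submanifold F : formal_solution relation F -> is_submanifold (subrelation F).
Proof.
by move=> solF; apply: (is_submanifold_open global_chart_jet); exact: subrelation_open.
Qed.

Lemma stretched_open F lam : formal_solution relation F ->
  open [set p : base X | stretched lam (jder (F p))].
Proof.
move=> solF.
pose f (p : base X) := sqnorm (restr lam (jder (F p))) - 4^-1 * sqnorm (jder (F p)) * sqnorm lam.
have -> : [set p : base X | stretched lam (jder (F p))] = f @^-1` [set r | 0 < r].
  by apply/seteqP; split=> p; rewrite /stretched /f /= subr_gt0.
suff /continuousP : continuous f by apply; exact: open_gt.
have cF i j : continuous (fun p => jder (F p) i j) by exact: solution_jder_continuous.
move=> p; apply: (@continuous_at_sub R (base X) (fun p => sqnorm (restr lam (jder (F p))))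
  (fun p => 4^-1 * sqnorm (jder (F p)) * sqnorm lam)).
  apply: continuous_sqnorm => i j; rewrite ord1.
  have -> : (fun p => restr lam (jder (F p)) 0 j) =
      (fun p => lam 0 0 * jder (F p) 1 j - lam 0 1 * jder (F p) 0 j).
    by apply/funext => y; rewrite restrE.
  apply: (@continuous_at_sub R (base X) (fun p => lam 0 0 * jder (F p) 1 j)
    (fun p => lam 0 1 * jder (F p) 0 j));
    by apply: continuousM; [exact: cst_continuous|exact: cF].
apply: continuousM; last exact: cst_continuous.
apply: continuousM; first exact: cst_continuous.
by apply: continuous_sqnorm => i j; exact: cF.
Qed.

(** A jet of [subrelation F] killing the kernel of [lam] has a differential lam (x) w, and its
    membership says that [F] contracts this kernel below the factor 1/4, against [stretched]. *)
Lemma subrelation_ample_along F (q : base X) lam : lam != 0 -> stretched lam (jder (F q)) ->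
  ample_along (subrelation F) (@jproj _ _ _ X 1 1 : J -> J) q (hyp q lam).
Proof.
move=> l0 sq; apply: ample_along_immersive => // [z zq Wz|z [_ Cz] zq].
  by split; [exact: wedge_admissible|left].
apply/negP => /eqP /(restr_eq0 l0)[w Dz]; move: Cz; rewrite Dz zq.
rewrite wedge_pure_tensor_self eqxx => -[//|].
rewrite wedge_pure_tensor sqnormN !sqnorm_tensor => lt.
have w0 := sqnorm_ge0 w.
have : 4^-1 * sqnorm (jder (F q)) * sqnorm lam * sqnorm w <=
    sqnorm (restr lam (jder (F q))) * sqnorm w by rewrite ler_wpM2r// ltW.
by rewrite leNgt -mulrA lt.
Qed.

Lemma subrelation_ample_coord F : formal_solution relation F ->
  @ample_coord R 2 3 X 1 (subrelation F).
Proof.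
move=> solF r' r1 p; have -> : r' = 1%N by apply/eqP; rewrite eqn_leq andbC.
have [_ SF _] := solF p.
have [lam [mu [l0 m0 dn0 sl sm]]] := stretched_pair (jder_neq0 SF).
(* The two hyperplanes chosen at [p] are kept constant; [U] is the open set where both remain
   stretched. *)
pose U : set (base X) := [set q | stretched lam (jder (F q))] `&` [set q | stretched mu (jder (F q))].
exists U, (frame lam mu); split=> //.
  by apply: (@principal_frame_constant _ _ _ _ p) => //; apply: openI; exact: stretched_open.
by move=> q tau [ql qm] [->|->]; exact: subrelation_ample_along.
Qed.

(** * A formal solution whose relation is neither ample nor Diff-invariant *)

Definition dz_dx : 'M[R]_(2, 3) := delta_mx 0 ord_max.
Definition dz_dy : 'M[R]_(2, 3) := delta_mx 1 ord_max.

Lemma dz_dxE : dz_dx = (basis_vec R 0)^T *m basis_vec R ord_max.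
Proof.
apply/matrixP => i j; rewrite pure_tensorE !mxE /= mulr_natr mulrb.
by case: eqP; case: eqP.
Qed.

Lemma dz_dyE : dz_dy = (basis_vec R 1)^T *m basis_vec R ord_max.
Proof.
apply/matrixP => i j; rewrite pure_tensorE !mxE /= mulr_natr mulrb.
by case: eqP; case: eqP.
Qed.

(** The value is 0 everywhere while the differential is that of (0, 0, x): a section that is not
    holonomic, of constant rank one, with kernel the y-axis. *)
Definition linear_solution (p : base X) : J := mkjet p 0 dz_dx.

Lemma linear_solutionP : formal_solution relation linear_solution.
Proof.
move=> p; split; first exact: jbase_mkjet.
  by apply/or3P; apply: Or31; rewrite jder_mkjet mxE !eqxx oner_eq0.
apply/(smooth_at_global_chart _ _ (@global_chart_euclid R 2) global_chart_jet).
apply: (@smooth_near_eq _ _ _ (fun y : 'rV[R]_2 => jvec y 0 dz_dx)).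
  by near=> y; rewrite /= jcoordE !mkjetE.
by apply: smooth_near_row_mx; [exact: smooth_near_id|exact: smooth_near_cst].
Unshelve. all: by end_near. Qed.

(** The attached relation contains the solution itself, whose rank one differential makes the kernel
    of dx a bad direction. *)
Lemma linear_solution_not_ample : ~ @ample R 2 3 X 1 (subrelation linear_solution).
Proof.
move=> /(_ 1%N isT) aF.
have l0 : (basis_vec R 0 : 'rV[R]_2) != 0.
  by apply/rV0Pn; exists 0; rewrite mxE !eqxx oner_eq0.
have [_ SF _] := subrelation_solution linear_solutionP 0.
have DF : jder (linear_solution 0) = (basis_vec R 0)^T *m basis_vec R ord_max.
  by rewrite jder_mkjet dz_dxE.
have := not_ample_along (@subrelation_sub linear_solution) SF l0 DF.
by apply; apply: aF; apply/is_hyperplaneP; eexists; first exact: l0.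
Qed.

Definition swap_mx : 'M[R]_2 := \matrix_(i, j) (i != j)%:R.

Definition swap_fun (p : base X) : base X := (p : 'rV[R]_2) *m swap_mx.

Lemma swap_mxK : swap_mx *m swap_mx = 1%:M.
Proof.
apply/matrixP => i j; rewrite mxE sum_ord2 !mxE; move: i j.
by apply: ord2_case; apply: ord2_case; rewrite /= ?mulr0 ?mul0r ?mulr1 ?addr0 ?add0r.
Qed.

Lemma swap_funK : involutive swap_fun.
Proof. by move=> p; rewrite /swap_fun -mulmxA swap_mxK mulmx1. Qed.

Lemma swap_fun_smooth p : smooth_at swap_fun p.
Proof.
apply/(smooth_at_global_chart _ _ (@global_chart_euclid R 2) (@global_chart_euclid R 2)).
apply: smooth_near_eq (smooth_near_mulmx swap_mx 0 p).
by near=> y; rewrite addr0.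
Unshelve. all: by end_near. Qed.

Lemma swap_fun_imT : swap_fun @` setT = setT.
Proof. by apply/seteqP; split=> // p _; exists (swap_fun p) => //; rewrite swap_funK. Qed.

Definition swap : loc_diffeo (base X).
Proof.
apply: (@LocDiffeo R 2 (base X) setT swap_fun swap_fun).
- exact: openT.
- by rewrite swap_fun_imT; exact: openT.
- by move=> p _; exact: swap_funK.
- by move=> p _; exact: swap_fun_smooth.
- by move=> p _; exact: swap_fun_smooth.
Defined.

(** Swapping x and y turns the jet of (0, 0, x) at the origin into that of (0, 0, y), whose kernel
    is the x-axis. The solution does not contract this axis: membership would read 1 < 1/4. *)
Lemma linear_solution_not_diff_invariant :
  ~ @diff_invariant R 2 3 X (@trivial_lift R 2 3) 1 (subrelation linear_solution).
Proof.
move=> /(_ swap (affine_germ 0 0 dz_dx) (affine_germ 0 0 dz_dy)) H.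
have [_ SF _] := subrelation_solution linear_solutionP 0.
have /H : pushes_germ (@trivial_lift R 2 3) swap (affine_germ 0 0 dz_dx) (affine_germ 0 0 dz_dy).
  split; [by []|by rewrite /= /swap_fun mul0mx|].
  near=> q; rewrite /= /trivial_lift /= [swap_fun _]swap_funK; congr (_, _ + _); last by rewrite !mul0mx.
  rewrite /swap_fun -mulmxA; congr (_ *m _).
  apply/matrixP => i j; rewrite [RHS]mxE sum_ord2 !mxE; move: i.
  by apply: ord2_case; rewrite /= ?mulr0 ?mul0r ?mul1r ?mulr1 ?addr0 ?add0r.
move=> /(_ SF)[_]; rewrite /linear_solution !jder_mkjet.
rewrite dz_dyE wedge_pure_tensor_self eqxx => -[//|].
rewrite wedge_pure_tensor dz_dxE sqnormN !sqnorm_tensor !sqnorm_basis.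
have -> : restr (basis_vec R 1) ((basis_vec R 0)^T *m basis_vec R ord_max) =
    - basis_vec R ord_max :> 'rV[R]_3.
  by apply/rowP => j; rewrite restrE !pure_tensorE !mxE /=; ring.
by rewrite sqnormN sqnorm_basis; lra.
Unshelve. all: by end_near. Qed.

End Subrelation.

Theorem corollary1p3 (R : realType) :
  exists (n k : nat) (X : bundle R n k)
         (lift : loc_diffeo (base X) -> total_space X -> total_space X)
         (r : nat) (S : set (jet_space X r)),
  [/\ is_fibre_bundle X /\ is_natural_bundle lift,
      open S,
      ample_up_to_avoidance S /\ diff_invariant lift S,
      ~ ample S /\ ~ ample_coord S &
      exists RF : (base X -> jet_space X r) -> set (jet_space X r),
      [/\ forall F, formal_solution S F ->
            [/\ is_submanifold (RF F), RF F `<=` S,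
                formal_solution (RF F) F & ample_coord (RF F)],
          ~ (forall F, formal_solution S F -> ample (RF F)) &
          ~ (forall F, formal_solution S F -> diff_invariant lift (RF F))]].
Proof.
exists 2%N, 3%N, (@trivial_bundle R 2 3), (@trivial_lift R 2 3), 1%N, (@relation R).
split.
- by split; [exact: trivial_is_fibre_bundle|exact: trivial_is_natural_bundle].
- exact: relation_open.
- by split; [exact: relation_ample_up_to_avoidance|exact: relation_diff_invariant].
- by split; [exact: relation_not_ample|exact: relation_not_ample_coord].
exists (@subrelation R); split=> [F solF|H|H].
- split; [exact: subrelation_submanifold|exact: subrelation_sub|
    exact: subrelation_solution|exact: subrelation_ample_coord].
- exact: linear_solution_not_ample (H _ (@linear_solutionP R)).
- exact: linear_solution_not_diff_invariant (H _ (@linear_solutionP R)).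
Qed.
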